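(* Let $G$ be a localic étale groupoid. The category $G\text{-}\mathbf{Loc}$ of $G$-locales and equivariant maps and the category $\mathcal O(G)\text{-}\mathbf{Loc}$ of $\mathcal O(G)$-locales are isomorphic.
   Context: Locales: $\mathbf{Loc}$ is the category of locales and continuous maps, the opposite of the category of frames and frame homomorphisms. For a locale $X$, $\mathcal O(X)$ is the corresponding frame; a map $f:X\to Y$ is given by its inverse image frame homomorphism $f^*:\mathcal O(Y)\to\mathcal O(X)$. If $f$ is open, $f_!:\mathcal O(X)\to\mathcal O(Y)$ denotes its direct image, the left adjoint of $f^*$. Involutive quantales and modules: an involutive quantale is a sup-lattice (complete lattice) $Q$ with an associative multiplication preserving arbitrary joins in each variable and a join-preserving involution $a\mapsto a^*$ with $a^{**}=a$ and $(ab)^*=b^*a^*$; it is unital if the multiplication has a unit $e$. $1$ denotes a top element. A (left) $Q$-module is a sup-lattice $M$ with an associative action $Q\times M\to M$ preserving joins in each variable, with $ex=x$ if $Q$ is unital. Homomorphisms of $Q$-modules preserve arbitrary joins and the action. Groupoids: a localic groupoid $G$ is an internal groupoid in $\mathbf{Loc}$, with locales of objects $G_0$ and arrows $G_1$, domain and range $d,r:G_1\to G_0$, units $u:G_0\to G_1$, inversion $i:G_1\to G_1$, multiplication $m:G_2\to G_1$, where $G_2$ is the pullback of $r$ (on the first projection) and $d$ (on the second projection). It is étale if $d$ is a local homeomorphism (then all structure maps are local homeomorphisms, in particular open). For $G$ étale, $\mathcal O(G)$ is the unital involutive quantale with underlying frame $\mathcal O(G_1)$, multiplication given by the composite $\mathcal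 O(G_1)\otimes\mathcal O(G_1)\to\mathcal O(G_2)\xrightarrow{m_!}\mathcal O(G_1)$ (the first arrow being the canonical quotient), involution $i_!$, and unit $e=u_!(1)$. $G$-locales: a (left) $G$-locale is a locale $X$ with a map $p:X\to G_0$ (the projection) and a map $\mathfrak a:G_1\times_{G_0}X\to X$ (the pullback being of $r$ and $p$) such that $p\circ\mathfrak a=d\circ\pi_1$; $\mathfrak a$ is associative, i.e. $\mathfrak a\circ(1\times\mathfrak a)=\mathfrak a\circ(m\times 1)$ under the canonical isomorphism $G_1\times_{G_0}(G_1\times_{G_0}X)\cong G_2\times_{G_0}X$; and $\mathfrak a\circ\langle u\circ p,1\rangle=\mathrm{id}_X$. An equivariant map $f:X\to Y$ of $G$-locales (with actions $\mathfrak a$, $\mathfrak b$) is a map of locales commuting with the projections to $G_0$ and satisfying $f\circ\mathfrak a=\mathfrak b\circ(1\times f)$. $Q$-locales: let $Q=\mathcal O(G)$ and $B=\{b\in Q\mid b\le e\}$. A $Q$-locale is a locale $X$ such that $\mathcal O(X)$ is equipped with a structure of (unital) left $Q$-module satisfying $bx=b1\wedge x$ for all $b\in B$ and $x\in\mathcal O(X)$. Morphisms $f:X\to Y$ in $Q\text{-}\mathbf{Loc}$ are the maps of locales such that $f^*:\mathcal O(Y)\to\mathcal O(X)$ is a homomorphism of $Q$-modules. *)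

(* Defs.v *)
From mathcomp Require Import all_boot.
From mathcomp Require Import boolp classical_sets.

Set Implicit Arguments.
Unset Strict Implicit.
Unset Printing Implicit Defensive.

Local Open Scope classical_set_scope.
Local Obligation Tactic := idtac.

Declare Scope locale_scope.
Delimit Scope locale_scope with loc.
Local Open Scope locale_scope.

Reserved Notation "x ⊑ y" (at level 70, no associativity).
Reserved Notation "x ⊓ y" (at level 40, left associativity).
Reserved Notation "⋁ S" (at level 35, right associativity).
Reserved Notation "⊤".
Reserved Notation "f ⊚ g" (at level 50, left associativity).
Reserved Notation "⟨ h , k | e ⟩".

Record supLattice := SupLattice {
  carrier :> Type;
  ple : carrier -> carrier -> Prop;
  join : set carrier -> carrier;
  ple_refl : forall x, ple x x;
  ple_anti : forall x y, ple x y -> ple y x -> x = y;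
  ple_trans : forall y x z, ple x y -> ple y z -> ple x z;
  join_ub : forall (S : set carrier) x, S x -> ple x (join S);
  join_least : forall (S : set carrier) y,
    (forall x, S x -> ple x y) -> ple (join S) y }.

Arguments ple {s} x y.
Arguments join {s} S.
Arguments ple_refl {s} x.
Arguments ple_trans {s y x z}.

Definition top {L : supLattice} : L := join setT.
Definition meet {L : supLattice} (x y : L) : L :=
  join [set z | ple z x /\ ple z y].
Definition inf {L : supLattice} (S : set L) : L :=
  join [set z | forall x, S x -> ple z x].

Arguments top : simpl never.
Arguments meet : simpl never.
Arguments inf : simpl never.

Notation "x ⊑ y" := (ple x y) : locale_scope.
Notation "x ⊓ y" := (meet x y) : locale_scope.
Notation "⋁ S" := (join S) : locale_scope.
Notation "⊤" := top : locale_scope.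

Section SupLatticeTheory.
Context {L : supLattice}.
Implicit Types (x y z : L) (S : set L).

Lemma meet_lb1 x y : x ⊓ y ⊑ x.
Proof. by apply: join_least => z []. Qed.

Lemma meet_lb2 x y : x ⊓ y ⊑ y.
Proof. by apply: join_least => z []. Qed.

Lemma meet_glb x y z : z ⊑ x -> z ⊑ y -> z ⊑ x ⊓ y.
Proof. by move=> zx zy; apply: join_ub. Qed.

Lemma le_top x : x ⊑ ⊤.
Proof. exact: join_ub. Qed.

Lemma meetC x y : x ⊓ y = y ⊓ x.
Proof. by apply: ple_anti; apply: meet_glb; (exact: meet_lb1 || exact: meet_lb2). Qed.

Lemma meetA x y z : x ⊓ (y ⊓ z) = x ⊓ y ⊓ z.
Proof.
apply: ple_anti.
  apply: meet_glb; last exact: ple_trans (meet_lb2 _ _) (meet_lb2 _ _).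
  apply: meet_glb; first exact: meet_lb1.
  exact: ple_trans (meet_lb2 _ _) (meet_lb1 _ _).
apply: meet_glb; first exact: ple_trans (meet_lb1 _ _) (meet_lb1 _ _).
apply: meet_glb; last exact: meet_lb2.
exact: ple_trans (meet_lb1 _ _) (meet_lb2 _ _).
Qed.

Lemma meet_l x y : x ⊑ y -> x ⊓ y = x.
Proof.
move=> xy; apply: ple_anti; first exact: meet_lb1.
by apply: meet_glb => //; exact: ple_refl.
Qed.

Lemma meet_mono x y x' y' : x ⊑ x' -> y ⊑ y' -> x ⊓ y ⊑ x' ⊓ y'.
Proof.
move=> h k; apply: meet_glb.
  exact: ple_trans (meet_lb1 _ _) h.
exact: ple_trans (meet_lb2 _ _) k.
Qed.

Lemma meet_top x : x ⊓ ⊤ = x.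
Proof. exact: meet_l (le_top _). Qed.

Lemma le_eqP x y : (forall z, x ⊑ z <-> y ⊑ z) -> x = y.
Proof. by move=> h; apply: ple_anti; apply/h; exact: ple_refl. Qed.

Lemma join_leP S y : ⋁ S ⊑ y <-> forall x, S x -> x ⊑ y.
Proof.
split=> [h x Sx|]; last exact: join_least.
exact: ple_trans (join_ub Sx) h.
Qed.

Lemma inf_lb S x : S x -> inf S ⊑ x.
Proof. by move=> Sx; apply: join_least => z; apply. Qed.

Lemma inf_glb S y : (forall x, S x -> y ⊑ x) -> y ⊑ inf S.
Proof. by move=> h; apply: join_ub. Qed.

Lemma join2 x y : x ⊑ y -> ⋁ [set x; y] = y.
Proof.
move=> xy; apply: ple_anti; last by apply: join_ub; right.
by apply: join_least => z [->|->] //; exact: ple_refl.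
Qed.

Lemma mono_of_join (L' : supLattice) (f : L -> L') :
  (forall S, f (⋁ S) = ⋁ [set f s | s in S]) -> forall x y, x ⊑ y -> f x ⊑ f y.
Proof.
move=> fJ x y xy; rewrite -(join2 xy) fJ; apply: join_ub.
by exists x => //; left.
Qed.

End SupLatticeTheory.

Ltac lat := lazymatch goal with
  | |- ?x ⊑ _ ⊓ _ => apply: meet_glb; lat
  | |- _ ⊑ ⊤ => exact: le_top
  | |- _ => first [ assumption | exact: ple_refl
      | apply: ple_trans (meet_lb1 _ _) _; lat
      | apply: ple_trans (meet_lb2 _ _) _; lat ]
  end.

Record frame := Frame {
  suplat :> supLattice;
  meet_join : forall (x : suplat) (S : set suplat),
    x ⊓ ⋁ S = ⋁ [set x ⊓ s | s in S] }.

Notation locale := frame.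

Record lmap (X Y : locale) := LMap {
  invim : Y -> X;
  invim_join : forall S : set Y, invim (⋁ S) = ⋁ [set invim s | s in S];
  invim_meet : forall y z : Y, invim (y ⊓ z) = invim y ⊓ invim z;
  invim_top : invim ⊤ = ⊤ }.

Notation "f ^*" := (invim f) : locale_scope.

Lemma invim_mono (X Y : locale) (f : lmap X Y) y z : y ⊑ z -> f^* y ⊑ f^* z.
Proof. by apply: mono_of_join => S; exact: invim_join. Qed.

Lemma lmap_ext (X Y : locale) (f g : lmap X Y) :
  (forall y, f^* y = g^* y) -> f = g.
Proof.
case: f g => [f f1 f2 f3] [g g1 g2 g3] /= /funext fg.
by subst g; congr LMap; exact: Prop_irrelevance.
Qed.

Program Definition lid (X : locale) : lmap X X := @LMap X X (fun x => x) _ _ _.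
Next Obligation. by move=> X S; rewrite image_id. Qed.
Next Obligation. by []. Qed.
Next Obligation. by []. Qed.

Program Definition lcomp (X Y Z : locale) (f : lmap Y Z) (g : lmap X Y) :
  lmap X Z := @LMap X Z (fun z => g^* (f^* z)) _ _ _.
Next Obligation. by move=> X Y Z f g S /=; rewrite !invim_join image_comp. Qed.
Next Obligation. by move=> X Y Z f g y z /=; rewrite !invim_meet. Qed.
Next Obligation. by move=> X Y Z f g /=; rewrite !invim_top. Qed.

Notation "f ⊚ g" := (lcomp f g) : locale_scope.

Lemma lcompA (X Y Z T : locale) (f : lmap Z T) (g : lmap Y Z) (h : lmap X Y) :
  f ⊚ (g ⊚ h) = f ⊚ g ⊚ h.
Proof. exact: lmap_ext. Qed.

Lemma lcomp1f (X Y : locale) (f : lmap X Y) : lid Y ⊚ f = f.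
Proof. exact: lmap_ext. Qed.

Lemma lcompf1 (X Y : locale) (f : lmap X Y) : f ⊚ lid X = f.
Proof. exact: lmap_ext. Qed.

Definition is_liso (X Y : locale) (f : lmap X Y) : Prop :=
  exists g : lmap Y X, f ⊚ g = lid Y /\ g ⊚ f = lid X.

Section OpenSublocale.
Context (X : locale) (u : X).

Let T := {x : X | x ⊑ u}.
Let le (x y : T) : Prop := sval x ⊑ sval y.

Lemma opn_join_subproof (S : set T) : ⋁ [set sval s | s in S] ⊑ u.
Proof. by apply: join_least => _ [s _ <-]; exact: (svalP s). Qed.

Let jn (S : set T) : T := exist (fun x => x ⊑ u) _ (opn_join_subproof S).

Lemma opn_val_inj (x y : T) : sval x = sval y -> x = y.
Proof.
case: x y => [x hx] [y hy] /= e; subst y.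
by congr exist; exact: Prop_irrelevance.
Qed.

Program Definition opn_suplat : supLattice := @SupLattice T le jn _ _ _ _ _.
Next Obligation. by move=> x; exact: ple_refl. Qed.
Next Obligation. by move=> x y h k; apply: opn_val_inj; exact: ple_anti. Qed.
Next Obligation. by move=> y x z; exact: ple_trans. Qed.
Next Obligation. by move=> S x Sx; apply: join_ub; exists x. Qed.
Next Obligation. by move=> S y h; apply: join_least => _ [s Ss <-]; exact: h. Qed.

Lemma opn_meetE (x y : opn_suplat) : sval (x ⊓ y) = sval x ⊓ sval y.
Proof.
apply: ple_anti.
  by apply: meet_glb; [exact: (meet_lb1 x y) | exact: (meet_lb2 x y)].
have h : sval x ⊓ sval y ⊑ u by apply: ple_trans (meet_lb1 _ _) (svalP x).
pose z : opn_suplat := exist (fun x => x ⊑ u) _ h.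
have : z ⊑ x ⊓ y by apply: meet_glb; [exact: meet_lb1 | exact: meet_lb2].
exact.
Qed.

Program Definition opn : locale := @Frame opn_suplat _.
Next Obligation.
move=> x S; apply: opn_val_inj; rewrite opn_meetE /= meet_join.
rewrite !image_comp; congr join; apply/eq_imagel => s _.
exact/esym/opn_meetE.
Qed.

Lemma opn_incl_subproof (x : X) : u ⊓ x ⊑ u.
Proof. exact: meet_lb1. Qed.

Program Definition opn_incl : lmap opn X :=
  @LMap opn X (fun x => exist (fun x => x ⊑ u) (u ⊓ x) (opn_incl_subproof x)) _ _ _.
Next Obligation.
by move=> S; apply: opn_val_inj; rewrite /= meet_join image_comp.
Qed.
Next Obligation.
by move=> x y; apply: opn_val_inj; rewrite opn_meetE /=; apply: ple_anti; lat.
Qed.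
Next Obligation.
apply: opn_val_inj => /=; apply: ple_anti; last first.
  apply: join_least => _ [s _ <-]; apply: meet_glb; last exact: le_top.
  exact: (svalP s).
by apply: join_ub; exists (exist (fun x => x ⊑ u) u (ple_refl u)) => //=; rewrite meet_top.
Qed.

End OpenSublocale.

Definition local_homeo (X Y : locale) (f : lmap X Y) : Prop :=
  exists2 S : set X, ⋁ S = ⊤ &
    forall u, S u -> exists (v : Y) (h : lmap (opn u) (opn v)),
      is_liso h /\ opn_incl v ⊚ h = f ⊚ opn_incl u.

(* The frame of the pullback of [f] and [g] is the tensor product of the frames
   over that of [Z], presented by C-ideals: [I x y] stands for "the basic open
   [f^* x ⊓ g^* y] is contained in [I]". *)
Section Pullback.
Context (X Y Z : locale) (f : lmap X Z) (g : lmap Y Z).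

Record C_ideal (I : X -> Y -> Prop) : Prop := CIdeal {
  ci_down : forall x x' y y', x' ⊑ x -> y' ⊑ y -> I x y -> I x' y';
  ci_joinl : forall (S : set X) y, (forall x, S x -> I x y) -> I (⋁ S) y;
  ci_joinr : forall x (S : set Y), (forall y, S y -> I x y) -> I x (⋁ S);
  ci_bal : forall x y z, I (x ⊓ f^* z) y <-> I x (y ⊓ g^* z) }.

Let T := {I : X -> Y -> Prop | C_ideal I}.
Let le (I J : T) : Prop := forall x y, sval I x y -> sval J x y.

Lemma ci_cap (F : (X -> Y -> Prop) -> Prop) :
  (forall J, F J -> C_ideal J) -> C_ideal (fun x y => forall J, F J -> J x y).
Proof.
move=> FC; split.
- by move=> x x' y y' hx hy h J FJ; apply: (ci_down (FC J FJ) hx hy); exact: h.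
- by move=> S y h J FJ; apply: (ci_joinl (FC J FJ)) => x Sx; exact: h.
- by move=> x S h J FJ; apply: (ci_joinr (FC J FJ)) => y Sy; exact: h.
- by move=> x y z; split=> h J FJ; apply/(ci_bal (FC J FJ)); exact: h.
Qed.

Definition ci_gen (R : X -> Y -> Prop) : T :=
  exist C_ideal
    (fun x y => forall J, C_ideal J /\ (forall a b, R a b -> J a b) -> J x y)
    (@ci_cap [set J | C_ideal J /\ forall a b, R a b -> J a b]
       (fun J h => proj1 h)).

Lemma ci_gen_sub (R : X -> Y -> Prop) x y : R x y -> sval (ci_gen R) x y.
Proof. by move=> h J [_]; apply. Qed.

Lemma ci_gen_min (R J : X -> Y -> Prop) : C_ideal J ->
  (forall x y, R x y -> J x y) -> forall x y, sval (ci_gen R) x y -> J x y.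
Proof. by move=> CJ RJ x y; apply. Qed.

Lemma ci_ext (I J : T) : (forall x y, sval I x y <-> sval J x y) -> I = J.
Proof.
case: I J => [I hI] [J hJ] /= h; have e : I = J.
  by apply/funext => x; apply/funext => y; exact/propext.
by subst J; congr exist; exact: Prop_irrelevance.
Qed.

Program Definition pbk_suplat : supLattice := @SupLattice T le
  (fun S => ci_gen (fun x y => exists2 I, S I & sval I x y)) _ _ _ _ _.
Next Obligation. by move=> I x y. Qed.
Next Obligation. by move=> I J h k; apply: ci_ext => x y; split; auto. Qed.
Next Obligation. by move=> J I K h k x y /h/k. Qed.
Next Obligation. by move=> S I SI x y Ixy; apply: ci_gen_sub; exists I. Qed.
Next Obligation.
move=> S J h; apply: ci_gen_min (svalP J) _ => x y [I SI]; exact: h.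
Qed.

Lemma pbk_meetE (I J : pbk_suplat) x y :
  sval (I ⊓ J) x y <-> sval I x y /\ sval J x y.
Proof.
split=> [h|[Ixy Jxy]].
  by split; [exact: (@meet_lb1 _ I J x y)|exact: (@meet_lb2 _ I J x y)].
have CK : C_ideal (fun a b => forall A, (A = sval I \/ A = sval J) -> A a b).
  by apply: ci_cap => A [->|->]; exact: svalP.
have : (exist _ _ CK : pbk_suplat) ⊑ I ⊓ J.
  by apply: meet_glb => a b /=; apply; [left|right].
by apply=> A [->|->].
Qed.

(* The Heyting implication of two C-ideals is a C-ideal. *)
Lemma ci_imp (I J : X -> Y -> Prop) : C_ideal I -> C_ideal J ->
  C_ideal (fun x y => forall a b, a ⊑ x -> b ⊑ y -> I a b -> J a b).
Proof.
move=> CI CJ; split.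
- move=> x x' y y' hx hy h a b ax by_ Iab.
  exact: h (ple_trans ax hx) (ple_trans by_ hy) Iab.
- move=> S y h a b aS hb Iab; rewrite -(meet_l aS) meet_join.
  apply: (ci_joinl CJ) => _ [s Ss <-]; apply: (h s Ss) => //; first exact: meet_lb2.
  by apply: (ci_down CI) Iab; [exact: meet_lb1|exact: ple_refl].
- move=> x S h a b ha bS Iab; rewrite -(meet_l bS) meet_join.
  apply: (ci_joinr CJ) => _ [s Ss <-]; apply: (h s Ss) => //; first exact: meet_lb2.
  by apply: (ci_down CI) Iab; [exact: ple_refl|exact: meet_lb1].
- move=> x y z; split=> h a b ha hb Iab.
    have e : b ⊓ g^* z = b by apply: meet_l; apply: ple_trans hb (meet_lb2 _ _).
    rewrite -e; apply/(ci_bal CJ); apply: h; last by apply/(ci_bal CI); rewrite e.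
      by apply: meet_mono => //; exact: ple_refl.
    by apply: ple_trans hb (meet_lb1 _ _).
  have e : a ⊓ f^* z = a by apply: meet_l; apply: ple_trans ha (meet_lb2 _ _).
  rewrite -e; apply/(ci_bal CJ); apply: h; last by apply/(ci_bal CI); rewrite e.
    by apply: ple_trans ha (meet_lb1 _ _).
  by apply: meet_mono => //; exact: ple_refl.
Qed.

Program Definition pbk : locale := @Frame pbk_suplat _.
Next Obligation.
move=> I S; apply: ple_anti; last first.
  apply: join_least => _ [s Ss <-]; apply: meet_mono; first exact: ple_refl.
  exact: join_ub.
set K := ⋁ [set _ | _ in S] => x y /pbk_meetE[Ixy Sxy].
have := ci_gen_min (ci_imp (svalP I) (svalP K)) _ Sxy.
apply; [|exact: ple_refl|exact: ple_refl|exact: Ixy].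
move=> {Ixy Sxy} {}x {}y [J SJ Jxy] a b ax by_ Iab; apply: ci_gen_sub.
exists (I ⊓ J); first by exists J.
apply/pbk_meetE; split=> //; exact: (ci_down (svalP J) ax by_ Jxy).
Qed.

Definition tens (x : X) (y : Y) : pbk := ci_gen (fun a b => a = x /\ b = y).

Local Arguments pbk : simpl never.

Lemma tens_in x y x' y' : x' ⊑ x -> y' ⊑ y -> sval (tens x y) x' y'.
Proof.
move=> hx hy; apply: (ci_down (svalP (tens x y)) hx hy); exact: ci_gen_sub.
Qed.

Lemma tens_le x y (I : pbk) : tens x y ⊑ I <-> sval I x y.
Proof.
split=> [|Ixy]; first by apply; exact: ci_gen_sub.
by apply: ci_gen_min (svalP I) _ => _ _ [-> ->].
Qed.

Lemma ci_meet_pred (J : pbk) x y :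
  C_ideal (fun a b => sval J (a ⊓ x) (b ⊓ y)).
Proof.
have CJ := svalP J; split.
- move=> a a' b b' ha hb; apply: (ci_down CJ); apply: meet_mono => //; exact: ple_refl.
- move=> S b h; rewrite meetC meet_join; apply: (ci_joinl CJ) => _ [s Ss <-].
  by rewrite meetC; exact: h.
- move=> a S h; rewrite [⋁ S ⊓ _]meetC meet_join; apply: (ci_joinr CJ) => _ [s Ss <-].
  by rewrite [y ⊓ _]meetC; exact: h.
- move=> a b z.
  have -> : a ⊓ f^* z ⊓ x = a ⊓ x ⊓ f^* z by apply: ple_anti; lat.
  have -> : b ⊓ g^* z ⊓ y = b ⊓ y ⊓ g^* z by apply: ple_anti; lat.
  exact: (ci_bal CJ).
Qed.

Lemma tens_meet x y x' y' :
  tens x y ⊓ tens x' y' = tens (x ⊓ x') (y ⊓ y').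
Proof.
apply: ple_anti; last first.
  apply/tens_le/pbk_meetE.
  by split; apply: tens_in; (exact: meet_lb1 || exact: meet_lb2).
set J := tens (x ⊓ x') _.
have h1 a b : sval (tens x y) a b -> sval J (a ⊓ x') (b ⊓ y').
  apply: ci_gen_min (ci_meet_pred _ _ _) _ a b => _ _ [-> ->].
  exact: ci_gen_sub.
move=> a b /pbk_meetE[/h1 h h'].
have CK := ci_imp (svalP (tens x y)) (svalP J).
have := ci_gen_min (ci_meet_pred J a b) _ h'; rewrite !meet_l; try exact: ple_refl.
by apply=> _ _ [-> ->]; rewrite meetC [_ ⊓ b]meetC.
Qed.

Lemma tens_top : tens ⊤ ⊤ = ⊤.
Proof.
apply: ple_anti; first exact: le_top.
by move=> x y _; apply: tens_in; exact: le_top.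
Qed.

Lemma tens_joinl (S : set X) y : tens (⋁ S) y = ⋁ [set tens x y | x in S].
Proof.
apply: ple_anti.
  set K := ⋁ [set _ | _ in _]; apply/tens_le.
  apply: (ci_joinl (svalP K)) => x Sx.
  by apply/tens_le; apply: join_ub; exists x.
apply: join_least => _ [x Sx <-]; apply/tens_le.
apply: tens_in (ple_refl _); exact: join_ub.
Qed.

Lemma tens_joinr x (S : set Y) : tens x (⋁ S) = ⋁ [set tens x y | y in S].
Proof.
apply: ple_anti.
  set K := ⋁ [set _ | _ in _]; apply/tens_le.
  apply: (ci_joinr (svalP K)) => y Sy.
  by apply/tens_le; apply: join_ub; exists y.
apply: join_least => _ [y Sy <-]; apply/tens_le.
apply: tens_in (ple_refl _) _; exact: join_ub.
Qed.

Lemma tens_bal x y z : tens (x ⊓ f^* z) y = tens x (y ⊓ g^* z).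
Proof.
by apply: le_eqP => I; split=> /tens_le h; apply/tens_le/(ci_bal (svalP I)).
Qed.

Lemma pbk_join_tens (I : pbk) :
  I = ⋁ [set t | exists x y, sval I x y /\ t = tens x y].
Proof.
apply: ple_anti => [x y Ixy|]; last first.
  by apply: join_least => _ [x [y [Ixy ->]]]; exact/tens_le.
by apply/tens_le; apply: join_ub; exists x, y.
Qed.

Program Definition pb1 : lmap pbk X := @LMap pbk X (fun x => tens x ⊤) _ _ _.
Next Obligation. by move=> S; exact: tens_joinl. Qed.
Next Obligation.
by move=> x y; rewrite -[RHS]/(tens _ _ ⊓ tens _ _) tens_meet meet_top.
Qed.
Next Obligation. exact: tens_top. Qed.

Program Definition pb2 : lmap pbk Y := @LMap pbk Y (fun y => tens ⊤ y) _ _ _.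
Next Obligation. by move=> S; exact: tens_joinr. Qed.
Next Obligation.
by move=> x y; rewrite -[RHS]/(tens _ _ ⊓ tens _ _) tens_meet meet_top.
Qed.
Next Obligation. exact: tens_top. Qed.

Lemma pb_comm : f ⊚ pb1 = g ⊚ pb2.
Proof.
apply: lmap_ext => z /=.
by rewrite -[f^* z]meet_top meetC tens_bal meetC meet_top.
Qed.

Lemma tensE x y : tens x y = pb1^* x ⊓ pb2^* y.
Proof.
rewrite -[RHS]/(tens _ _ ⊓ tens _ _) tens_meet meet_top.
by rewrite [⊤ ⊓ y]meetC meet_top.
Qed.

Section Pairing.
Context (W : locale) (h : lmap W X) (k : lmap W Y) (e : f ⊚ h = g ⊚ k).

Definition pb_inv (I : pbk) : W :=
  ⋁ [set w | exists x y, sval I x y /\ w = h^* x ⊓ k^* y].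

Lemma pb_inv_le (w : W) : C_ideal (fun x y => h^* x ⊓ k^* y ⊑ w).
Proof.
split.
- move=> x x' y y' hx hy; apply: ple_trans.
  by apply: meet_mono; exact: invim_mono.
- move=> S y H; rewrite invim_join meetC meet_join.
  by apply: join_least => _ [_ [s Ss <-] <-]; rewrite meetC; exact: H.
- move=> x S H; rewrite invim_join meet_join.
  by apply: join_least => _ [_ [s Ss <-] <-]; exact: H.
- move=> x y z; have ez : h^* (f^* z) = k^* (g^* z).
    by have := congr1 (fun m => m^* z) e.
  rewrite !invim_meet ez.
  suff -> : h^* x ⊓ k^* (g^* z) ⊓ k^* y = h^* x ⊓ (k^* y ⊓ k^* (g^* z)) by [].
  by apply: ple_anti; lat.
Qed.

Lemma pb_inv_tens x y : pb_inv (tens x y) = h^* x ⊓ k^* y.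
Proof.
apply: ple_anti; last by apply: join_ub; exists x, y; split=> //; exact: ci_gen_sub.
apply: join_least => _ [a [b [Iab ->]]]; move: Iab.
apply: (ci_gen_min (pb_inv_le _)) => _ _ [-> ->]; exact: ple_refl.
Qed.

Lemma pb_inv_mono I J : I ⊑ J -> pb_inv I ⊑ pb_inv J.
Proof.
move=> IJ; apply: join_least => _ [a [b [Iab ->]]].
by apply: join_ub; exists a, b; split=> //; exact: IJ.
Qed.

Program Definition pb_pair : lmap W pbk := @LMap W pbk pb_inv _ _ _.
Next Obligation.
move=> S; apply: ple_anti; last first.
  by apply: join_least => _ [I SI <-]; apply: pb_inv_mono; exact: join_ub.
apply: join_least => _ [a [b [Iab ->]]]; move: Iab.
apply: (ci_gen_min (pb_inv_le _)) => x y [I SI Ixy].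
apply: ple_trans (join_ub (imageP _ SI)); apply: join_ub; by exists x, y.
Qed.
Next Obligation.
move=> I J /=; apply: ple_anti.
  by apply: meet_glb; apply: pb_inv_mono; [exact: meet_lb1|exact: meet_lb2].
rewrite {2}/pb_inv meet_join; apply: join_least => _ [_ [a [b [Jab ->]]] <-].
rewrite meetC meet_join; apply: join_least => _ [_ [x [y [Ixy ->]]] <-].
have hk : h^* (x ⊓ a) ⊓ k^* (y ⊓ b) ⊑ pb_inv (I ⊓ J).
  apply: join_ub; exists (x ⊓ a), (y ⊓ b); split=> //; apply/pbk_meetE; split.
    exact: (ci_down (svalP I) (meet_lb1 _ _) (meet_lb1 _ _) Ixy).
  exact: (ci_down (svalP J) (meet_lb2 _ _) (meet_lb2 _ _) Jab).
by apply: ple_trans hk; rewrite !invim_meet; lat.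
Qed.
Next Obligation. by rewrite -tens_top pb_inv_tens !invim_top meet_top. Qed.

Lemma pb_pairK1 : pb1 ⊚ pb_pair = h.
Proof. by apply: lmap_ext => x /=; rewrite pb_inv_tens invim_top meet_top. Qed.

Lemma pb_pairK2 : pb2 ⊚ pb_pair = k.
Proof.
by apply: lmap_ext => x /=; rewrite pb_inv_tens invim_top meetC meet_top.
Qed.

End Pairing.

Lemma pb_ext (W : locale) (h k : lmap W pbk) :
  pb1 ⊚ h = pb1 ⊚ k -> pb2 ⊚ h = pb2 ⊚ k -> h = k.
Proof.
move=> e1 e2; apply: lmap_ext => I; rewrite (pbk_join_tens I) !invim_join.
congr join; apply/eq_imagel => _ [x [y [_ ->]]]; rewrite tensE !invim_meet.
have := congr1 (fun m => m^* x) e1; have := congr1 (fun m => m^* y) e2.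
by move=> /= -> ->.
Qed.

End Pullback.

Arguments pbk {X Y Z} f g : simpl never.
Arguments pb1 {X Y Z f g}.
Arguments pb2 {X Y Z f g}.
Arguments pb_comm {X Y Z} f g.

(* The map into the pullback with components [h] and [k]; [e] is a proof that
   these form a commutative square. *)
Notation "⟨ h , k | e ⟩" := (@pb_pair _ _ _ _ _ _ h k e) : locale_scope.

(* The only candidate for a left adjoint of [f^*]; it is one when [f] is open. *)
Definition dirim (X Y : locale) (f : lmap X Y) (x : X) : Y :=
  inf [set y | x ⊑ f^* y].

Definition is_open (X Y : locale) (f : lmap X Y) : Prop :=
  (forall x y, dirim f x ⊑ y <-> x ⊑ f^* y) /\
  (forall x y, dirim f (x ⊓ f^* y) = dirim f x ⊓ y).

Section Open.
Context (X Y : locale).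
Implicit Type f : lmap X Y.

Lemma open_intro f (g : X -> Y) :
  (forall x y, g x ⊑ y <-> x ⊑ f^* y) ->
  (forall x y, g x ⊓ y ⊑ g (x ⊓ f^* y)) ->
  is_open f /\ forall x, dirim f x = g x.
Proof.
move=> adj frob.
have E x : dirim f x = g x.
  apply: ple_anti; first by apply: inf_lb; apply/adj; exact: ple_refl.
  by apply: inf_glb => y h; exact/adj.
split=> //; split=> [x y|x y]; rewrite !E //; apply: ple_anti => //.
have xg : x ⊑ f^* (g x) by apply/adj; exact: ple_refl.
apply/adj; rewrite invim_meet; apply: meet_mono => //; exact: ple_refl.
Qed.

Context (f : lmap X Y) (fo : is_open f).

Lemma dirim_adj x y : dirim f x ⊑ y <-> x ⊑ f^* y.
Proof. exact: fo.1. Qed.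

Lemma frobenius x y : dirim f (x ⊓ f^* y) = dirim f x ⊓ y.
Proof. exact: fo.2. Qed.

Lemma dirim_unit x : x ⊑ f^* (dirim f x).
Proof. by apply/dirim_adj; exact: ple_refl. Qed.

Lemma dirim_join (S : set X) : dirim f (⋁ S) = ⋁ [set dirim f x | x in S].
Proof.
apply: le_eqP => y; rewrite dirim_adj !join_leP; split=> h.
  by move=> _ [x Sx <-]; apply/dirim_adj; exact: h.
by move=> x Sx; apply/dirim_adj; apply: h; exists x.
Qed.

End Open.

Lemma open_comp (X Y Z : locale) (f : lmap Y Z) (g : lmap X Y) :
  is_open f -> is_open g ->
  is_open (f ⊚ g) /\ forall x, dirim (f ⊚ g) x = dirim f (dirim g x).
Proof.
move=> fo go; apply: open_intro => x y; first by rewrite !dirim_adj.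
by rewrite /= !frobenius //; exact: ple_refl.
Qed.

Lemma open_iso (X Y : locale) (f : lmap X Y) (g : lmap Y X) :
  f ⊚ g = lid Y -> g ⊚ f = lid X ->
  is_open f /\ forall x, dirim f x = g^* x.
Proof.
move=> fg gf.
have fgK y : g^* (f^* y) = y by exact: (congr1 (fun h => h^* y) fg).
have gfK x : f^* (g^* x) = x by exact: (congr1 (fun h => h^* x) gf).
apply: open_intro => x y.
  split=> h; first by rewrite -(gfK x); exact: invim_mono.
  by rewrite -(fgK y); exact: invim_mono.
by rewrite invim_meet fgK; exact: ple_refl.
Qed.

Lemma dirim_id (X : locale) (x : X) : dirim (lid X) x = x.
Proof. exact: (open_iso (lcomp1f (lid X)) (lcomp1f (lid X))).2. Qed.

Lemma dirim_comp_iso (X Y Z : locale) (f : lmap Y Z) (g : lmap X Y) y :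
  is_open f -> is_liso g -> dirim (f ⊚ g) (g^* y) = dirim f y.
Proof.
move=> fo [h [gh hg]]; have [go gE] := open_iso gh hg.
rewrite (open_comp fo go).2 gE; congr dirim.
exact: (congr1 (fun k => k^* y) gh).
Qed.

Section LocalHomeo.
Context (X Y : locale) (f : lmap X Y) (S : set X) (coverS : ⋁ S = ⊤).
Hypothesis chartS : forall u, S u -> exists (v : Y) (h : lmap (opn u) (opn v)),
  is_liso h /\ opn_incl v ⊚ h = f ⊚ opn_incl u.

Lemma chart u : S u -> exists v : Y,
  (forall x, exists2 w, w ⊑ v & x ⊓ u = f^* w ⊓ u) /\
  (forall w b, w ⊑ v -> f^* w ⊓ u ⊑ f^* b -> w ⊑ b).
Proof.
move=> /chartS[v [h [[g [hg gh]] E]]]; exists v.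
have EE y : sval (h^* ((opn_incl v)^* y)) = u ⊓ f^* y.
  exact: (congr1 (fun k : lmap (opn u) Y => sval (k^* y)) E).
have hgK y : g^* (h^* y) = y by exact: (congr1 (fun k => k^* y) hg).
have ghK x : h^* (g^* x) = x by exact: (congr1 (fun k => k^* x) gh).
have inclK (y : opn v) : (opn_incl v)^* (sval y) = y.
  by apply: opn_val_inj; rewrite /= meetC meet_l //; exact: (svalP y).
split=> [x|w b wv wb].
  pose c := (opn_incl u)^* x; exists (sval (g^* c)); first exact: (svalP (g^* c)).
  by rewrite [RHS]meetC -EE inclK ghK /= meetC.
have iw : sval ((opn_incl v)^* w) = w by rewrite /= meetC meet_l.
rewrite -iw; suff le : (opn_incl v)^* w ⊑ (opn_incl v)^* b.
  by apply: ple_trans (le : sval _ ⊑ _) (meet_lb2 _ _).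
rewrite -[X in X ⊑ _]hgK -[X in _ ⊑ X]hgK; apply: invim_mono.
by rewrite /ple /= !EE; apply: meet_glb; [exact: meet_lb1|rewrite meetC].
Qed.

Lemma cover_le (x y : X) : (forall u, S u -> x ⊓ u ⊑ y) -> x ⊑ y.
Proof.
move=> h; rewrite -(meet_top x) -coverS meet_join.
by apply: join_least => _ [u Su <-]; exact: h.
Qed.

Lemma chart_dirim u x w v : S u ->
  (forall w b, w ⊑ v -> f^* w ⊓ u ⊑ f^* b -> w ⊑ b) ->
  w ⊑ v -> x ⊓ u = f^* w ⊓ u -> forall y, w ⊓ y ⊑ dirim f (x ⊓ f^* y).
Proof.
move=> Su H wv E y; apply: inf_glb => b xb; apply: H; first by lat.
apply: ple_trans xb; rewrite invim_meet.
have : f^* w ⊓ u ⊑ x by rewrite -E; lat.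
move=> h; apply: meet_glb; last by lat.
by apply: ple_trans h; lat.
Qed.

Lemma chart_open : is_open f.
Proof.
have un x : x ⊑ f^* (dirim f x).
  apply: cover_le => u Su; have [v [H1 H2]] := chart Su.
  have [w wv E] := H1 x; rewrite E; apply: ple_trans (meet_lb1 _ _) _.
  apply: invim_mono; have := chart_dirim Su H2 wv E ⊤.
  by rewrite invim_top !meet_top.
have adj x y : dirim f x ⊑ y <-> x ⊑ f^* y.
  split=> h; last exact: inf_lb.
  by apply: ple_trans (un x) _; exact: invim_mono.
apply: (open_intro adj _).1 => x y.
pose W := [set w | forall y, w ⊓ y ⊑ dirim f (x ⊓ f^* y)].
have xW : dirim f x ⊑ ⋁ W.
  apply/adj/cover_le => u Su; have [v [H1 H2]] := chart Su.
  have [w wv E] := H1 x; rewrite E; apply: ple_trans (meet_lb1 _ _) _.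
  by apply: invim_mono; apply: join_ub; exact: chart_dirim Su H2 wv E.
apply: ple_trans (meet_mono xW (ple_refl y)) _.
by rewrite meetC meet_join; apply: join_least => _ [w Ww <-]; rewrite meetC.
Qed.

Lemma chart_section_open (s : lmap Y X) : f ⊚ s = lid Y -> is_open s.
Proof.
move=> fs; have sf y : s^* (f^* y) = y by exact: (congr1 (fun h => h^* y) fs).
pose g (z : Y) : X := ⋁ [set u ⊓ f^* (s^* u ⊓ z) | u in S].
have key z b u : S u -> u ⊓ b ⊓ f^* (s^* u ⊓ z) ⊑ u ⊓ f^* (s^* u ⊓ (z ⊓ s^* b)).
  move=> Su; have [v [H1 H2]] := chart Su; have [w wv E] := H1 b.
  rewrite [u ⊓ b]meetC E.
  have wb : f^* (s^* u ⊓ w) ⊑ f^* (s^* b).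
    apply: invim_mono; rewrite -{1}(sf w) -invim_meet; apply: invim_mono.
    by rewrite meetC -E; lat.
  rewrite !invim_meet in wb *; apply: meet_glb; first by lat.
  apply: meet_glb; first by lat.
  apply: meet_glb; first by lat.
  by apply: ple_trans wb; lat.
suff adj z b : g z ⊑ b <-> z ⊑ s^* b.
  apply: (open_intro adj _).1 => z b.
  rewrite meetC meet_join; apply: join_least => _ [_ [u Su <-] <-].
  apply: ple_trans (join_ub (imageP _ Su)).
  by apply: ple_trans (key _ _ _ Su); lat.
split=> [h|h].
  apply: ple_trans (invim_mono s h).
  rewrite invim_join image_comp.
  have cS : ⋁ [set s^* u | u in S] = ⊤ by rewrite -invim_join coverS invim_top.
  rewrite -{1}(meet_top z) -cS meet_join; apply: join_least => _ [_ [u Su <-] <-].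
  apply: ple_trans (join_ub (imageP _ Su)); rewrite /= invim_meet sf.
  by lat.
apply: join_least => _ [u Su <-].
have [v [H1 H2]] := chart Su; have [w wv E] := H1 b.
suff : u ⊓ f^* (s^* u ⊓ z) ⊑ f^* w ⊓ u by rewrite -E => k; apply: ple_trans k _; lat.
have : s^* u ⊓ z ⊑ w.
  apply: (@ple_trans _ (s^* (b ⊓ u))).
    by rewrite invim_meet; apply: meet_glb; [apply: ple_trans h; lat|lat].
  by rewrite E invim_meet sf; lat.
move=> /(invim_mono f) k; apply: meet_glb; last by lat.
by apply: ple_trans k; lat.
Qed.

End LocalHomeo.

Lemma local_homeo_open (X Y : locale) (f : lmap X Y) :
  local_homeo f -> is_open f.
Proof. by move=> [S cS hS]; exact: (chart_open cS hS). Qed.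

Lemma local_homeo_section_open (X Y : locale) (f : lmap X Y) (s : lmap Y X) :
  local_homeo f -> f ⊚ s = lid Y -> is_open s.
Proof. by move=> [S cS hS]; exact: (chart_section_open cS hS). Qed.

Lemma pb2_open (X Y Z : locale) (f : lmap X Z) (g : lmap Y Z) : is_open f ->
  is_open (pb2 : lmap (pbk f g) Y) /\
  forall x, dirim pb2 ((pb1 : lmap (pbk f g) X)^* x) = g^* (dirim f x).
Proof.
move=> fo.
pose G (I : pbk f g) : Y :=
  ⋁ [set w | exists x y, sval I x y /\ w = g^* (dirim f x) ⊓ y].
have CI b : C_ideal f g (fun x y => g^* (dirim f x) ⊓ y ⊑ b).
  have dmono x x' : x ⊑ x' -> dirim f x ⊑ dirim f x'.
    by apply: mono_of_join => S; exact: dirim_join.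
  split.
  - move=> x x' y y' hx hy; apply: ple_trans; apply: meet_mono => //.
    by apply: invim_mono; exact: dmono.
  - move=> S y h; rewrite dirim_join // invim_join meetC meet_join.
    by apply: join_least => _ [_ [_ [s Ss <-] <-] <-]; rewrite meetC; exact: h.
  - move=> x S h; rewrite meet_join.
    by apply: join_least => _ [s Ss <-]; exact: h.
  - move=> x y z; rewrite frobenius // invim_meet -meetA.
    by rewrite [y ⊓ _]meetC.
have adj I b : G I ⊑ b <-> I ⊑ pb2^* b.
  split=> h.
    rewrite (pbk_join_tens I); apply: join_least => _ [x [y [Ixy ->]]].
    have -> : x = x ⊓ f^* (dirim f x) by rewrite meet_l //; exact: dirim_unit.
    rewrite tens_bal; apply/tens_le; apply: tens_in; first exact: le_top.
    by apply: ple_trans h; rewrite meetC; apply: join_ub; exists x, y.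
  apply: join_least => _ [x [y [/h + ->]]].
  apply: (ci_gen_min (CI b)) => _ _ [-> ->]; exact: meet_lb2.
have frob I y : G I ⊓ y ⊑ G (I ⊓ pb2^* y).
  rewrite meetC meet_join.
  apply: join_least => _ [_ [a [b [Iab ->]]] <-]; apply: join_ub.
  exists a, (b ⊓ y); split; last by apply: ple_anti; lat.
  apply/pbk_meetE; split.
    exact: (ci_down (svalP I) (ple_refl _) (meet_lb1 _ _) Iab).
  by apply: tens_in; [exact: le_top|exact: meet_lb2].
have [o E] := open_intro adj frob.
split=> // x; rewrite E; apply: ple_anti; last first.
  apply: join_ub; exists x, ⊤; split; last by rewrite meet_top.
  exact: ci_gen_sub.
apply: join_least => _ [a [b [h ->]]]; move: h.
by apply: (ci_gen_min (CI _)) => _ _ [-> ->]; exact: meet_lb1.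
Qed.

Lemma beck_chevalley (P X Y Z : locale) (f : lmap X Z) (g : lmap Y Z)
    (p : lmap P X) (q : lmap P Y) (j : lmap (pbk f g) P) :
  is_open f -> f ⊚ p = g ⊚ q -> p ⊚ j = pb1 -> q ⊚ j = pb2 ->
  (forall h k : lmap P P, p ⊚ h = p ⊚ k -> q ⊚ h = q ⊚ k -> h = k) ->
  is_open q /\ forall x, dirim q (p^* x) = g^* (dirim f x).
Proof.
move=> fo e pj qj mono; pose t := ⟨ p , q | e ⟩.
have tj : t ⊚ j = lid _.
  by apply: pb_ext; rewrite lcompA ?pb_pairK1 ?pb_pairK2 lcompf1.
have jt : j ⊚ t = lid _.
  by apply: mono; rewrite lcompA ?pj ?qj ?pb_pairK1 ?pb_pairK2 lcompf1.
have [o bc] := pb2_open g fo; have qE : q = pb2 ⊚ t by rewrite pb_pairK2.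
have pE : p = pb1 ⊚ t by rewrite pb_pairK1.
split; first by rewrite qE; exact: (open_comp o (open_iso tj jt).1).1.
move=> x; rewrite qE pE -bc /=; apply: dirim_comp_iso => //; by exists j.
Qed.

Lemma id_times_comm (A X Y Z : locale) (r : lmap A Z) (p : lmap X Z)
    (q : lmap Y Z) (f : lmap X Y) :
  q ⊚ f = p -> r ⊚ pb1 = q ⊚ (f ⊚ pb2) :> lmap (pbk r p) Z.
Proof. by move=> e; rewrite lcompA e; exact: pb_comm. Qed.

(* [1 × f] *)
Definition id_times (A X Y Z : locale) (r : lmap A Z) (p : lmap X Z)
    (q : lmap Y Z) (f : lmap X Y) (e : q ⊚ f = p) : lmap (pbk r p) (pbk r q) :=
  ⟨ pb1 , f ⊚ pb2 | id_times_comm r e ⟩.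

Lemma times_id_comm (A B X Z : locale) (s : lmap A Z) (r : lmap B Z)
    (p : lmap X Z) (m : lmap A B) :
  r ⊚ m = s -> r ⊚ (m ⊚ pb1) = p ⊚ pb2 :> lmap (pbk s p) Z.
Proof. by move=> e; rewrite lcompA e; exact: pb_comm. Qed.

(* [m × 1] *)
Definition times_id (A B X Z : locale) (s : lmap A Z) (r : lmap B Z)
    (p : lmap X Z) (m : lmap A B) (e : r ⊚ m = s) : lmap (pbk s p) (pbk r p) :=
  ⟨ m ⊚ pb1 , pb2 | times_id_comm p e ⟩.

Section PullbackAssoc.
Context (A B X Z Z' : locale) (r : lmap A Z) (d : lmap B Z) (r' : lmap B Z')
  (p : lmap X Z').
Let P := pbk (r' ⊚ pb2 : lmap (pbk r d) Z') p.
Let P' := pbk r (d ⊚ pb1 : lmap (pbk r' p) Z).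

Lemma pb_assoc_comm1 : r ⊚ pb1 = d ⊚ (pb1 ⊚ pb2) :> lmap P' Z.
Proof. by rewrite lcompA; exact: pb_comm. Qed.

Lemma pb_assoc_comm2 :
  (r' ⊚ pb2) ⊚ ⟨ pb1 , pb1 ⊚ pb2 | pb_assoc_comm1 ⟩ = p ⊚ (pb2 ⊚ pb2).
Proof. by rewrite -lcompA pb_pairK2 !lcompA pb_comm. Qed.

(* The canonical isomorphism A × (B × X) ≅ (A × B) × X *)
Definition pb_assoc : lmap P' P :=
  ⟨ ⟨ pb1 , pb1 ⊚ pb2 | pb_assoc_comm1 ⟩ , pb2 ⊚ pb2 | pb_assoc_comm2 ⟩.

Local Notation α := pb_assoc.

Lemma pb_assoc11 : pb1 ⊚ (pb1 ⊚ α) = pb1.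
Proof. by rewrite /pb_assoc !pb_pairK1. Qed.

Lemma pb_assoc12 : pb2 ⊚ (pb1 ⊚ α) = pb1 ⊚ pb2.
Proof. by rewrite /pb_assoc pb_pairK1 pb_pairK2. Qed.

Lemma pb_assoc2 : pb2 ⊚ α = pb2 ⊚ pb2.
Proof. by rewrite /pb_assoc pb_pairK2. Qed.

Lemma pb_assoc_iso : is_liso α.
Proof.
have e1 : r' ⊚ (pb2 ⊚ pb1) = p ⊚ pb2 :> lmap P Z'.
  by rewrite lcompA; exact: pb_comm.
have e2 : r ⊚ (pb1 ⊚ pb1) = (d ⊚ pb1) ⊚ ⟨ pb2 ⊚ pb1 , pb2 | e1 ⟩ :> lmap P Z.
  by rewrite -[RHS]lcompA pb_pairK1 !lcompA pb_comm.
pose β := ⟨ pb1 ⊚ pb1 , ⟨ pb2 ⊚ pb1 , pb2 | e1 ⟩ | e2 ⟩.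
have β1 : pb1 ⊚ β = pb1 ⊚ pb1 by rewrite pb_pairK1.
have β21 : pb1 ⊚ (pb2 ⊚ β) = pb2 ⊚ pb1 by rewrite !(pb_pairK2, pb_pairK1).
have β22 : pb2 ⊚ (pb2 ⊚ β) = pb2 by rewrite !(pb_pairK2, pb_pairK1).
exists β; split.
  apply: pb_ext; rewrite [X in X = _]lcompA lcompf1.
    apply: pb_ext; rewrite [X in X = _]lcompA.
      by rewrite pb_assoc11 β1.
    by rewrite pb_assoc12 -lcompA β21.
  by rewrite pb_assoc2 -lcompA β22.
apply: pb_ext; rewrite [X in X = _]lcompA lcompf1.
  by rewrite β1 -lcompA pb_assoc11.
apply: pb_ext; rewrite [X in X = _]lcompA.
  by rewrite β21 -lcompA pb_assoc12.
by rewrite β22 pb_assoc2.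
Qed.

End PullbackAssoc.

Lemma unit_comm (A B X : locale) (r : lmap A B) (u : lmap B A) (p : lmap X B) :
  r ⊚ u = lid B -> r ⊚ (u ⊚ p) = p ⊚ lid X.
Proof. by move=> e; rewrite lcompA e lcomp1f lcompf1. Qed.

Lemma comp_lid_comm (A B C : locale) (f : lmap A B) (g : lmap C B)
  (h : lmap A C) : g ⊚ h = f -> f ⊚ lid A = g ⊚ h.
Proof. by move=> ->; rewrite lcompf1. Qed.

(* [mul] takes a pair of arrows [(g, h)] with [ran g = dom h] to [gh], so that
   [dom (gh) = dom g] and [ran (gh) = ran h]. *)
Record groupoid := Groupoid {
  obj : locale;
  arr : locale;
  dom : lmap arr obj;
  ran : lmap arr obj;
  unt : lmap obj arr;
  inv : lmap arr arr;
  mul : lmap (pbk ran dom) arr;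
  dom_unt : dom ⊚ unt = lid obj;
  ran_unt : ran ⊚ unt = lid obj;
  dom_inv : dom ⊚ inv = ran;
  ran_inv : ran ⊚ inv = dom;
  dom_mul : dom ⊚ mul = dom ⊚ pb1;
  ran_mul : ran ⊚ mul = ran ⊚ pb2;
  mulA : mul ⊚ id_times ran dom_mul =
         mul ⊚ times_id dom ran_mul ⊚ pb_assoc ran dom ran dom;
  mul1l : mul ⊚ ⟨ unt ⊚ dom , lid arr | unit_comm dom ran_unt ⟩ = lid arr;
  mul1r : mul ⊚ ⟨ lid arr , unt ⊚ ran | esym (unit_comm ran dom_unt) ⟩ = lid arr;
  mulVr : mul ⊚ ⟨ lid arr , inv | comp_lid_comm dom_inv ⟩ = unt ⊚ dom;
  mulVl : mul ⊚ ⟨ inv , lid arr | esym (comp_lid_comm ran_inv) ⟩ = unt ⊚ ran }.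

Record etaleGroupoid := EtaleGroupoid {
  gpd :> groupoid;
  dom_etale : local_homeo (dom gpd) }.

Record gLocale (G : groupoid) := GLocale {
  gspace :> locale;
  proj : lmap gspace (obj G);
  act : lmap (pbk (ran G) proj) gspace;
  act_proj : proj ⊚ act = dom G ⊚ pb1;
  actA : act ⊚ id_times (ran G) act_proj =
         act ⊚ times_id proj (ran_mul G) ⊚ pb_assoc (ran G) (dom G) (ran G) proj;
  act1 : act ⊚ ⟨ unt G ⊚ proj , lid gspace | unit_comm proj (ran_unt G) ⟩ =
         lid gspace }.

Record gMap (G : groupoid) (X Y : gLocale G) := GMap {
  gmap :> lmap X Y;
  gmap_proj : proj Y ⊚ gmap = proj X;
  gmap_act : gmap ⊚ act X = act Y ⊚ id_times (ran G) gmap_proj }.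

Record uiQuantale := UIQuantale {
  qcar :> supLattice;
  qmul : qcar -> qcar -> qcar;
  qstar : qcar -> qcar;
  qone : qcar;
  qmulA : forall a b c, qmul a (qmul b c) = qmul (qmul a b) c;
  qmul_joinl : forall (S : set qcar) b, qmul (⋁ S) b = ⋁ [set qmul a b | a in S];
  qmul_joinr : forall a (S : set qcar), qmul a (⋁ S) = ⋁ [set qmul a b | b in S];
  qmul1l : forall a, qmul qone a = a;
  qmul1r : forall a, qmul a qone = a;
  qstar_join : forall S : set qcar, qstar (⋁ S) = ⋁ [set qstar a | a in S];
  qstarK : forall a, qstar (qstar a) = a;
  qstarM : forall a b, qstar (qmul a b) = qmul (qstar b) (qstar a) }.

Record qModule (Q : uiQuantale) (M : supLattice) := QModule {
  qact :> Q -> M -> M;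
  qactA : forall a b x, qact a (qact b x) = qact (qmul a b) x;
  qact1 : forall x, qact (qone Q) x = x;
  qact_joinl : forall (S : set Q) x, qact (⋁ S) x = ⋁ [set qact a x | a in S];
  qact_joinr : forall a (S : set M), qact a (⋁ S) = ⋁ [set qact a x | x in S] }.

Record qLocale (Q : uiQuantale) := QLocale {
  qspace :> locale;
  qstr : qModule Q qspace;
  qlocal : forall (b : Q) (x : qspace), b ⊑ qone Q -> qstr b x = qstr b ⊤ ⊓ x }.

Record qMap (Q : uiQuantale) (X Y : qLocale Q) := QMap {
  qmap :> lmap X Y;
  qmap_act : forall (a : Q) (y : Y), qmap^* (qstr Y a y) = qstr X a (qmap^* y) }.

Lemma pair_comp (X Y Z W V : locale) (f : lmap X Z) (g : lmap Y Z)
    (h : lmap W X) (k : lmap W Y) (e : f ⊚ h = g ⊚ k) (t : lmap V W)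
    (h' : lmap V X) (k' : lmap V Y) (e' : f ⊚ h' = g ⊚ k') :
  h ⊚ t = h' -> k ⊚ t = k' -> ⟨ h , k | e ⟩ ⊚ t = ⟨ h' , k' | e' ⟩.
Proof.
by move=> eh ek; apply: pb_ext; rewrite lcompA ?pb_pairK1 ?pb_pairK2.
Qed.

Section GLocaleTheory.
Context (G : groupoid) (X : gLocale G).

Definition av (W : locale) (g : lmap W (arr G)) (x : lmap W X)
  (e : ran G ⊚ g = proj X ⊚ x) : lmap W X := act X ⊚ ⟨ g , x | e ⟩.

Lemma av_proj W g x e : proj X ⊚ @av W g x e = dom G ⊚ g.
Proof. by rewrite lcompA act_proj -lcompA pb_pairK1. Qed.

Lemma av_comp W V g x e (t : lmap V W) g' x' e' :
  g ⊚ t = g' -> x ⊚ t = x' -> @av W g x e ⊚ t = @av V g' x' e'.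
Proof. by move=> eg ex; rewrite -lcompA (pair_comp _ e' eg ex). Qed.

Lemma av_eq W g x e g' x' e' : g = g' -> x = x' -> @av W g x e = @av W g' x' e'.
Proof. by move=> eg ex; subst g' x'; rewrite (Prop_irrelevance e e'). Qed.

Lemma act_av W (t : lmap W (pbk (ran G) (proj X))) e :
  act X ⊚ t = @av W (pb1 ⊚ t) (pb2 ⊚ t) e.
Proof.
by congr lcomp; apply: pb_ext; rewrite ?pb_pairK1 ?pb_pairK2.
Qed.

Lemma avA W (g h : lmap W (arr G)) (x : lmap W X) e1 e2 e3 e4 :
  @av W g (@av W h x e1) e2 = @av W (mul G ⊚ ⟨ g , h | e3 ⟩) x e4.
Proof.
have e5 : ran G ⊚ g = (dom G ⊚ pb1) ⊚ ⟨ h , x | e1 ⟩.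
  by rewrite -lcompA pb_pairK1.
have := congr1 (fun k => k ⊚ ⟨ g , ⟨ h , x | e1 ⟩ | e5 ⟩) (actA X).
rewrite -!lcompA => E; rewrite /av.
have -> : ⟨ g, act X ⊚ ⟨ h, x | e1 ⟩ | e2 ⟩ =
    id_times (ran G) (act_proj X) ⊚ ⟨ g , ⟨ h , x | e1 ⟩ | e5 ⟩.
  apply: esym; apply: pair_comp; first by rewrite pb_pairK1.
  by rewrite -lcompA pb_pairK2.
rewrite E; congr lcomp; apply: pair_comp.
  rewrite -lcompA; congr lcomp; rewrite lcompA pb_pairK1.
  apply: pair_comp; first by rewrite pb_pairK1.
  by rewrite -lcompA pb_pairK2 pb_pairK1.
by rewrite lcompA pb_pairK2 -lcompA !pb_pairK2.
Qed.

Lemma av1 W (x : lmap W X) (t : lmap W (obj G)) e : @av W (unt G ⊚ t) x e = x.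
Proof.
have et : t = proj X ⊚ x by rewrite -e lcompA ran_unt lcomp1f.
have := congr1 (fun k => k ⊚ x) (act1 X); rewrite lcomp1f => {2}<-.
rewrite -lcompA /av; congr lcomp; apply: esym; apply: pair_comp.
  by rewrite -lcompA -et.
exact: lcomp1f.
Qed.

End GLocaleTheory.

Definition regular (G : groupoid) : gLocale G :=
  @GLocale G (arr G) (dom G) (mul G) (dom_mul G) (mulA G) (mul1l G).

Section GroupoidTheory.
Context (G : groupoid).

Definition mu (W : locale) (g h : lmap W (arr G))
  (e : ran G ⊚ g = dom G ⊚ h) : lmap W (arr G) := mul G ⊚ ⟨ g , h | e ⟩.
Arguments mu {W} g h e.

Lemma mu_eq W g h e g' h' e' : g = g' -> h = h' -> @mu W g h e = @mu W g' h' e'.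
Proof. exact: (@av_eq G (regular G)). Qed.

Lemma muA W (g h k : lmap W (arr G)) e1 e2 e3 e4 :
  mu g (mu h k e1) e2 = mu (mu g h e3) k e4.
Proof. exact: (@avA G (regular G)). Qed.

Lemma mu1l W (g : lmap W (arr G)) t e : mu (unt G ⊚ t) g e = g.
Proof. exact: (@av1 G (regular G)). Qed.

Lemma muVl W (g : lmap W (arr G)) e : mu (inv G ⊚ g) g e = unt G ⊚ (ran G ⊚ g).
Proof.
rewrite lcompA -mulVl -lcompA; congr lcomp; apply: esym.
by apply: pair_comp; rewrite ?lcomp1f.
Qed.

Lemma muVr W (g : lmap W (arr G)) e : mu g (inv G ⊚ g) e = unt G ⊚ (dom G ⊚ g).
Proof.
rewrite lcompA -mulVr -lcompA; congr lcomp; apply: esym.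
by apply: pair_comp; rewrite ?lcomp1f.
Qed.

Lemma mu1r W (g : lmap W (arr G)) t e : mu g (unt G ⊚ t) e = g.
Proof.
have et : t = ran G ⊚ g.
  by rewrite e /= lcompA dom_unt lcomp1f.
have := congr1 (fun k => k ⊚ g) (mul1r G); rewrite lcomp1f => {2}<-.
rewrite -lcompA /mu; congr lcomp; apply: esym; apply: pair_comp.
  exact: lcomp1f.
by rewrite -lcompA -et.
Qed.

Lemma mu_dom W (g h : lmap W (arr G)) e : dom G ⊚ mu g h e = dom G ⊚ g.
Proof. exact: (@av_proj G (regular G)). Qed.

Lemma mu_ran W (g h : lmap W (arr G)) e : ran G ⊚ mu g h e = ran G ⊚ h.
Proof. by rewrite lcompA ran_mul -lcompA pb_pairK2. Qed.

Lemma inv_uniq W (g h : lmap W (arr G)) t e :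
  mu g h e = unt G ⊚ t -> h = inv G ⊚ g.
Proof.
move=> E; have e1 : ran G ⊚ (inv G ⊚ g) = dom G ⊚ mu g h e.
  by rewrite lcompA ran_inv mu_dom.
have e2 : ran G ⊚ (inv G ⊚ g) = dom G ⊚ g by rewrite lcompA ran_inv.
have e3 : ran G ⊚ (unt G ⊚ (ran G ⊚ g)) = dom G ⊚ h.
  by rewrite lcompA ran_unt lcomp1f.
have e4 : ran G ⊚ (inv G ⊚ g) = dom G ⊚ (unt G ⊚ t) by rewrite e1 E.
have e5 : ran G ⊚ mu (inv G ⊚ g) g e2 = dom G ⊚ h by rewrite mu_ran.
rewrite -(mu1r e4) -(mu_eq e1 e4 erefl E).
rewrite (muA e1 e5) (mu_eq e5 e3 _ erefl) ?mu1l //; exact: muVl.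
Qed.

Lemma invK : inv G ⊚ inv G = lid (arr G).
Proof.
have e : ran G ⊚ (inv G ⊚ lid _) = dom G ⊚ lid _ by rewrite lcompA ran_inv.
have := inv_uniq (muVl e); rewrite lcompA !lcompf1.
by move=> <-.
Qed.

Lemma inv_iso : is_liso (inv G).
Proof. by exists (inv G); split; exact: invK. Qed.

Lemma inv_mu W (g h : lmap W (arr G)) e e' :
  inv G ⊚ mu g h e = mu (inv G ⊚ h) (inv G ⊚ g) e'.
Proof.
have e1 : ran G ⊚ h = dom G ⊚ mu (inv G ⊚ h) (inv G ⊚ g) e'.
  by rewrite mu_dom lcompA dom_inv.
have e2 : ran G ⊚ g = dom G ⊚ mu h (mu (inv G ⊚ h) (inv G ⊚ g) e') e1.
  by rewrite mu_dom.
have e3 : ran G ⊚ mu g h e = dom G ⊚ mu (inv G ⊚ h) (inv G ⊚ g) e'.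
  by rewrite mu_ran.
apply: esym; apply: (inv_uniq (e := e3) (t := dom G ⊚ g)).
have e4 : ran G ⊚ h = dom G ⊚ (inv G ⊚ h) by rewrite lcompA dom_inv.
have e5 : ran G ⊚ mu h (inv G ⊚ h) e4 = dom G ⊚ (inv G ⊚ g).
  by rewrite muVr lcompA ran_unt lcomp1f -e lcompA dom_inv.
have e6 : ran G ⊚ g = dom G ⊚ (inv G ⊚ g) by rewrite lcompA dom_inv.
have e7 : ran G ⊚ (unt G ⊚ (dom G ⊚ h)) = dom G ⊚ (inv G ⊚ g).
  by rewrite -muVr -e5.
rewrite -(muA e2 e3) -(muVr e6); apply: mu_eq => //.
rewrite (muA e1 e5) (mu_eq e5 e7 (muVr e4) erefl); exact: mu1l.
Qed.

End GroupoidTheory.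

Arguments mu {G W} g h e.

Section EtaleTheory.
Context (G : etaleGroupoid).

Lemma dom_open : is_open (dom G).
Proof. exact: local_homeo_open (dom_etale G). Qed.

Lemma unt_open : is_open (unt G).
Proof. exact: local_homeo_section_open (dom_etale G) (dom_unt G). Qed.

Section Action.
Context (X : gLocale G).
Local Notation P := (pbk (ran G) (proj X)).

Lemma act_open : is_open (act X).
Proof.
pose P' := pbk (dom G) (proj X).
have e1 : ran G ⊚ (inv G ⊚ pb1) = proj X ⊚ pb2 :> lmap P' _.
  by rewrite lcompA ran_inv; exact: pb_comm.
have e2 : ran G ⊚ pb1 = proj X ⊚ av e1 :> lmap P' _.
  by rewrite av_proj lcompA dom_inv.
have e3 : dom G ⊚ (pb1 : lmap P _) = proj X ⊚ act X by rewrite act_proj.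
pose j : lmap P' P := ⟨ pb1 , av e1 | e2 ⟩.
apply: (beck_chevalley (j := j) dom_open e3 _ _ _).1.
- by rewrite pb_pairK1.
- have e4 : ran G ⊚ pb1 = dom G ⊚ (inv G ⊚ pb1) :> lmap P' _.
    by rewrite lcompA dom_inv.
  have e5 : ran G ⊚ mu pb1 (inv G ⊚ pb1) e4 = proj X ⊚ pb2 :> lmap P' _.
    by rewrite mu_ran e1.
  have e6 : ran G ⊚ (unt G ⊚ (dom G ⊚ pb1)) = proj X ⊚ pb2 :> lmap P' _.
    by rewrite lcompA ran_unt lcomp1f; exact: pb_comm.
  have -> : act X ⊚ j = av e2 by [].
  by rewrite (avA e2 e5) (av_eq e5 e6 (muVr e4) erefl) av1.
move=> h k E1 E2; apply: pb_ext => //.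
suff H (t : lmap P P) :
    exists e : ran G ⊚ (inv G ⊚ (pb1 ⊚ t)) = proj X ⊚ (act X ⊚ t),
    pb2 ⊚ t = av e.
  have [e ->] := H h; have [e' ->] := H k.
  by apply: av_eq => //; rewrite E1.
have f1 : ran G ⊚ (inv G ⊚ (pb1 ⊚ t)) = proj X ⊚ (act X ⊚ t).
  by rewrite !lcompA ran_inv act_proj.
have f2 : ran G ⊚ (pb1 ⊚ t) = proj X ⊚ (pb2 ⊚ t) by rewrite !lcompA pb_comm.
have f3 : ran G ⊚ (inv G ⊚ (pb1 ⊚ t)) = proj X ⊚ av f2 by rewrite -act_av.
have f4 : ran G ⊚ (inv G ⊚ (pb1 ⊚ t)) = dom G ⊚ (pb1 ⊚ t).
  by rewrite lcompA ran_inv.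
have f5 : ran G ⊚ mu (inv G ⊚ (pb1 ⊚ t)) (pb1 ⊚ t) f4 = proj X ⊚ (pb2 ⊚ t).
  by rewrite mu_ran.
have f6 : ran G ⊚ (unt G ⊚ (ran G ⊚ (pb1 ⊚ t))) = proj X ⊚ (pb2 ⊚ t).
  by rewrite lcompA ran_unt lcomp1f.
exists f1; rewrite (av_eq f1 f3 erefl (act_av f2)) (avA f3 f5).
by rewrite (av_eq f5 f6 (muVl f4) erefl) av1.
Qed.

Definition dact (a : arr G) (x : X) : X :=
  dirim (act X) ((pb1 : lmap P _)^* a ⊓ (pb2 : lmap P _)^* x).

Lemma dact_joinl (S : set (arr G)) x :
  dact (⋁ S) x = ⋁ [set dact a x | a in S].
Proof.
rewrite /dact invim_join meetC meet_join (dirim_join act_open) !image_comp.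
by congr join; apply: eq_imagel => a _ /=; rewrite meetC.
Qed.

Lemma dact_joinr a (S : set X) : dact a (⋁ S) = ⋁ [set dact a x | x in S].
Proof.
by rewrite /dact invim_join meet_join (dirim_join act_open) !image_comp.
Qed.

Lemma dact1 x : dact (dirim (unt G) ⊤) x = x.
Proof.
pose s : lmap X P := ⟨ unt G ⊚ proj X , lid X | unit_comm (proj X) (ran_unt G) ⟩.
have s1 : pb1 ⊚ s = unt G ⊚ proj X by rewrite pb_pairK1.
have s2 : pb2 ⊚ s = lid X by rewrite pb_pairK2.
pose j : lmap (pbk (unt G) (pb1 : lmap P _)) X := pb2 ⊚ pb2.
have pj : proj X ⊚ j = pb1.
  rewrite /j lcompA -pb_comm -lcompA -pb_comm lcompA ran_unt.
  exact: lcomp1f.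
have [so bc] : is_open s /\
    forall y, dirim s ((proj X)^* y) = (pb1 : lmap P _)^* (dirim (unt G) y).
  apply: (beck_chevalley (j := j) unt_open (esym s1) pj).
    apply: pb_ext; rewrite lcompA.
      by rewrite s1 -lcompA pj; exact: pb_comm.
    by rewrite s2 lcomp1f.
  move=> h k _ E; rewrite -(lcomp1f h) -(lcomp1f k) -s2 -!lcompA.
  by congr lcomp.
rewrite /dact -bc invim_top -(frobenius so) meetC meet_top.
rewrite -(open_comp act_open so).2 (act1 X) dirim_id.
exact: (congr1 (fun k : lmap X X => k^* x) s2).
Qed.

End Action.

(* On a pure tensor [a ⊗ b] the quotient from the tensor product of sup-lattices
   [O(G_1) ⊗ O(G_1)] onto [O(G_2)] takes the value [pb1^* a ⊓ pb2^* b]. *)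
Definition omul (a b : arr G) : arr G :=
  dirim (mul G) (pb1^* a ⊓ pb2^* b).

Definition ostar (a : arr G) : arr G := dirim (inv G) a.

Definition oone : arr G := dirim (unt G) ⊤.

Lemma mul_open : is_open (mul G).
Proof. exact: (act_open (regular G)). Qed.

Lemma dactA (X : gLocale G) a b (x : X) :
  dact a (dact b x) = dact (omul a b) x.
Proof.
pose P := pbk (ran G) (proj X); pose P2 := pbk (ran G) (dom G).
pose L := pbk (ran G) (dom G ⊚ pb1 : lmap P _).
pose R := pbk (ran G ⊚ pb2 : lmap P2 _) (proj X).
pose l : lmap L P := id_times (ran G) (act_proj X).
pose t : lmap R P := times_id (proj X) (ran_mul G).
have l1 : pb1 ⊚ l = pb1 by exact: pb_pairK1.
have l2 : pb2 ⊚ l = act X ⊚ pb2 by exact: pb_pairK2.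
have t1 : pb1 ⊚ t = mul G ⊚ pb1 by exact: pb_pairK1.
have t2 : pb2 ⊚ t = pb2 by exact: pb_pairK2.
have [lo lbc] : is_open l /\ forall y,
    dirim l ((pb2 : lmap L _)^* y) = (pb2 : lmap P _)^* (dirim (act X) y).
  pose Q := pbk (act X) (pb2 : lmap P _).
  have e : ran G ⊚ (pb1 ⊚ pb2) = (dom G ⊚ pb1) ⊚ pb1 :> lmap Q _.
    by rewrite -act_proj -lcompA pb_comm !lcompA pb_comm.
  apply: (beck_chevalley (j := ⟨ pb1 ⊚ pb2 , pb1 | e ⟩) (act_open X) (esym l2)).
  - by rewrite pb_pairK2.
  - apply: pb_ext; rewrite lcompA.
      by rewrite l1 pb_pairK1.
    by rewrite l2 -lcompA pb_pairK2; exact: pb_comm.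
  - move=> h k e2 e1; apply: pb_ext => //.
    by rewrite -l1 -!lcompA e1.
have [to tbc] : is_open t /\ forall y,
    dirim t ((pb1 : lmap R _)^* y) = (pb1 : lmap P _)^* (dirim (mul G) y).
  pose Q := pbk (mul G) (pb1 : lmap P _).
  have e : (ran G ⊚ pb2) ⊚ pb1 = proj X ⊚ (pb2 ⊚ pb2) :> lmap Q _.
    by rewrite -ran_mul -lcompA pb_comm !lcompA pb_comm.
  apply: (beck_chevalley (j := ⟨ pb1 , pb2 ⊚ pb2 | e ⟩) mul_open (esym t1)).
  - by rewrite pb_pairK1.
  - apply: pb_ext; rewrite lcompA.
      by rewrite t1 -lcompA pb_pairK1; exact: pb_comm.
    by rewrite t2 pb_pairK2.
  - move=> h k e1 e2; apply: pb_ext => //.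
    by rewrite -t2 -!lcompA e2.
have L1 : dact a (dact b x) = dirim (act X ⊚ l)
    ((pb1 : lmap L _)^* a ⊓ (pb2 : lmap L _)^* (pb1^* b ⊓ pb2^* x)).
  rewrite (open_comp (act_open X) lo).2 /dact -lbc meetC -(frobenius lo).
  rewrite [X in dirim _ (dirim _ X)]meetC.
  congr (dirim _ (dirim _ (_ ⊓ _))).
  exact: (congr1 (fun k : lmap L _ => k^* a) l1).
have R1 : dact (omul a b) x = dirim (act X ⊚ t)
    ((pb1 : lmap R _)^* (pb1^* a ⊓ pb2^* b) ⊓ (pb2 : lmap R _)^* x).
  rewrite (open_comp (act_open X) to).2 /dact -tbc -(frobenius to).
  congr (dirim _ (dirim _ (_ ⊓ _))).
  exact: (congr1 (fun k : lmap R _ => k^* x) t2).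
pose α := pb_assoc (ran G) (dom G) (ran G) (proj X).
have to' := (open_comp (act_open X) to).1.
rewrite L1 R1 (actA X) -(dirim_comp_iso _ to' (pb_assoc_iso _ _ _ _)).
congr dirim; rewrite !invim_meet -meetA.
have a1 := congr1 (fun k : lmap L _ => k^* a) (pb_assoc11 (ran G) (dom G) (ran G) (proj X)).
have a2 := congr1 (fun k : lmap L _ => k^* b) (pb_assoc12 (ran G) (dom G) (ran G) (proj X)).
have a3 := congr1 (fun k : lmap L _ => k^* x) (pb_assoc2 (ran G) (dom G) (ran G) (proj X)).
by congr (_ ⊓ (_ ⊓ _)); symmetry.
Qed.

Lemma omul1r a : omul a oone = a.
Proof.
pose P := pbk (ran G) (dom G).
pose s : lmap (arr G) P :=
  ⟨ lid _ , unt G ⊚ ran G | esym (unit_comm (ran G) (dom_unt G)) ⟩.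
have s1 : pb1 ⊚ s = lid _ by rewrite pb_pairK1.
have s2 : pb2 ⊚ s = unt G ⊚ ran G by rewrite pb_pairK2.
pose j : lmap (pbk (unt G) (pb2 : lmap P _)) (arr G) := pb1 ⊚ pb2.
have pj : ran G ⊚ j = pb1.
  rewrite /j lcompA pb_comm -lcompA -pb_comm lcompA dom_unt.
  exact: lcomp1f.
have [so bc] : is_open s /\
    forall y, dirim s ((ran G)^* y) = (pb2 : lmap P _)^* (dirim (unt G) y).
  apply: (beck_chevalley (j := j) unt_open (esym s2) pj).
    apply: pb_ext; rewrite lcompA.
      by rewrite s1 lcomp1f.
    by rewrite s2 -lcompA pj; exact: pb_comm.
  move=> h k _ E; rewrite -(lcomp1f h) -(lcomp1f k) -s1 -!lcompA.
  by congr lcomp.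
rewrite /omul -bc invim_top meetC -(frobenius so) meetC meet_top.
rewrite -(open_comp mul_open so).2 (mul1r G) dirim_id.
exact: (congr1 (fun k : lmap (arr G) _ => k^* a) s1).
Qed.

Lemma ostarE a : ostar a = (inv G)^* a.
Proof. exact: (open_iso (invK G) (invK G)).2. Qed.

Lemma ostarK a : ostar (ostar a) = a.
Proof.
rewrite !ostarE; exact: (congr1 (fun k : lmap (arr G) _ => k^* a) (invK G)).
Qed.

Lemma ostar_join (S : set (arr G)) : ostar (⋁ S) = ⋁ [set ostar a | a in S].
Proof.
by rewrite ostarE invim_join; congr join; apply: eq_imagel => a _; rewrite ostarE.
Qed.

Lemma ostarM a b : ostar (omul a b) = omul (ostar b) (ostar a).
Proof.
pose P := pbk (ran G) (dom G).
have e : ran G ⊚ (inv G ⊚ pb2) = dom G ⊚ (inv G ⊚ pb1) :> lmap P _.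
  by rewrite !lcompA ran_inv dom_inv pb_comm.
pose σ : lmap P P := ⟨ inv G ⊚ pb2 , inv G ⊚ pb1 | e ⟩.
have σ1 : pb1 ⊚ σ = inv G ⊚ pb2 by rewrite pb_pairK1.
have σ2 : pb2 ⊚ σ = inv G ⊚ pb1 by rewrite pb_pairK2.
have σK : σ ⊚ σ = lid P.
  apply: pb_ext; rewrite lcompA lcompf1 ?σ1 ?σ2 -lcompA ?σ1 ?σ2 lcompA invK;
    exact: lcomp1f.
have [io _] := open_iso (invK G) (invK G).
have iM : inv G ⊚ mul G = mul G ⊚ σ.
  have := inv_mu (pb_comm (ran G) (dom G)) e; rewrite /mu.
  suff -> : ⟨ pb1 , pb2 | pb_comm (ran G) (dom G) ⟩ = lid _ by rewrite lcompf1.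
  by apply: pb_ext; rewrite lcompf1 ?pb_pairK1 ?pb_pairK2.
rewrite {1}/ostar /omul -(open_comp io mul_open).2 iM !ostarE.
have E1 : σ^* ((pb2 : lmap P _)^* b) = (pb1 : lmap P _)^* ((inv G)^* b).
  exact: (congr1 (fun k : lmap P _ => k^* b) σ2).
have E2 : σ^* ((pb1 : lmap P _)^* a) = (pb2 : lmap P _)^* ((inv G)^* a).
  exact: (congr1 (fun k : lmap P _ => k^* a) σ1).
rewrite -E1 -E2 -invim_meet meetC; have [so sE] := open_iso σK σK.
by rewrite (open_comp mul_open so).2 sE.
Qed.

End EtaleTheory.

Definition OG (G : etaleGroupoid) : uiQuantale :=
  @UIQuantale (arr G) (@omul G) (@ostar G) (oone G)
    (@dactA G (regular G)) (@dact_joinl G (regular G))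
    (@dact_joinr G (regular G)) (@dact1 G (regular G)) (@omul1r G)
    (@ostar_join G) (@ostarK G) (@ostarM G).

Record category := Category {
  ob :> Type;
  hom : ob -> ob -> Type;
  idm : forall x, hom x x;
  comp : forall x y z, hom y z -> hom x y -> hom x z;
  compA : forall x y z t (h : hom z t) (g : hom y z) (f : hom x y),
    comp h (comp g f) = comp (comp h g) f;
  comp1m : forall x y (f : hom x y), comp (idm y) f = f;
  compm1 : forall x y (f : hom x y), comp f (idm x) = f }.

Arguments idm {c} x.
Arguments comp {c x y z} g f.

Record functor (C D : category) := Functor {
  fob :> C -> D;
  fmap : forall x y : C, hom x y -> hom (fob x) (fob y);
  fmap_id : forall x : C, fmap (idm x) = idm (fob x);
  fmap_comp : forall (x y z : C) (g : hom y z) (f : hom x y),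
    fmap (comp g f) = comp (fmap g) (fmap f) }.

Definition fid (C : category) : functor C C :=
  @Functor C C (fun x => x) (fun _ _ f => f) (fun _ => erefl)
    (fun _ _ _ _ _ => erefl).

Program Definition fcomp (C D E : category) (G : functor D E) (F : functor C D) :
  functor C E := @Functor C E (fun x => G (F x)) (fun _ _ f => fmap G (fmap F f)) _ _.
Next Obligation. by move=> C D E G F x /=; rewrite !fmap_id. Qed.
Next Obligation. by move=> C D E G F x y z g f /=; rewrite !fmap_comp. Qed.

(* The composites are compared by Leibniz equality, so this is isomorphism, not
   equivalence, of categories. *)
Definition isomorphic_categories (C D : category) : Prop :=
  exists (F : functor C D) (G : functor D C),
    fcomp G F = fid C /\ fcomp F G = fid D.

Section GLoc.
Context (G : groupoid).

Lemma gMap_ext (X Y : gLocale G) (f g : gMap X Y) : gmap f = gmap g -> f = g.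
Proof.
case: f g => [f f1 f2] [g g1 g2] /= fg; subst g.
have e1 : f1 = g1 by exact: Prop_irrelevance.
by subst g1; congr GMap; exact: Prop_irrelevance.
Qed.

Program Definition gid (X : gLocale G) : gMap X X :=
  @GMap G X X (lid X) (lcompf1 _) _.
Next Obligation.
move=> X; rewrite lcomp1f -[LHS]lcompf1; congr lcomp.
apply: pb_ext; rewrite lcompf1 /id_times ?pb_pairK1 ?pb_pairK2 //.
exact/esym/lcomp1f.
Qed.

Lemma gcomp_proj (X Y Z : gLocale G) (g : gMap Y Z) (f : gMap X Y) :
  proj Z ⊚ (g ⊚ f) = proj X.
Proof. by rewrite lcompA !gmap_proj. Qed.

Program Definition gcomp (X Y Z : gLocale G) (g : gMap Y Z) (f : gMap X Y) :
  gMap X Z := @GMap G X Z (g ⊚ f) (gcomp_proj g f) _.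
Next Obligation.
move=> X Y Z g f; rewrite -lcompA gmap_act lcompA gmap_act -lcompA.
congr lcomp; apply: pb_ext; rewrite lcompA /id_times ?pb_pairK1 ?pb_pairK2 //.
by rewrite -lcompA pb_pairK2 lcompA.
Qed.

Program Definition GLoc : category :=
  @Category (gLocale G) (@gMap G) gid gcomp _ _ _.
Next Obligation. by move=> *; apply: gMap_ext; exact: lcompA. Qed.
Next Obligation. by move=> *; apply: gMap_ext; exact: lcomp1f. Qed.
Next Obligation. by move=> *; apply: gMap_ext; exact: lcompf1. Qed.

End GLoc.

Section QLoc.
Context (Q : uiQuantale).

Lemma qMap_ext (X Y : qLocale Q) (f g : qMap X Y) : qmap f = qmap g -> f = g.
Proof.
case: f g => [f f1] [g g1] /= fg; subst g.
by congr QMap; exact: Prop_irrelevance.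
Qed.

Definition qid (X : qLocale Q) : qMap X X :=
  @QMap Q X X (lid X) (fun _ _ => erefl).

Program Definition qcomp (X Y Z : qLocale Q) (g : qMap Y Z) (f : qMap X Y) :
  qMap X Z := @QMap Q X Z (g ⊚ f) _.
Next Obligation. by move=> X Y Z g f a z /=; rewrite !qmap_act. Qed.

Program Definition QLoc : category :=
  @Category (qLocale Q) (@qMap Q) qid qcomp _ _ _.
Next Obligation. by move=> *; apply: qMap_ext; exact: lcompA. Qed.
Next Obligation. by move=> *; apply: qMap_ext; exact: lcomp1f. Qed.
Next Obligation. by move=> *; apply: qMap_ext; exact: lcompf1. Qed.

End QLoc.

(* Main.v *)
From mathcomp Require Import all_boot.
From mathcomp Require Import boolp classical_sets.
Require Import Defs.

(** Write [e] for the unit of the quantale [OG G], [a°] for the involution, and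
    call [s] a partial unit when [s ⊙ s° ⊑ e] and [s° ⊙ s ⊑ e]; these are the
    opens of local bisections. Both functors keep underlying locales and maps,
    so the theorem says that an action of [G] on a locale [X] and a local action
    of [OG G] on [X] are the same data, preserved by the same maps.

    From the groupoid to the quantale, the action map is open and [a] acts by
    [dact a x], the direct image of [a ⊗ x]. An element below [e] is the direct
    image along the units of an open [z] of objects, and acts as the meet with
    the inverse image of [z] under the projection ([dact_unt]); hence
    locality.

    Conversely, the projection of a Q-locale is forced to have inverse image
    [z ↦ u_!(z) ▷ ⊤], and since direct image along the action has to be
    [a ⊗ y ↦ a ▷ y], its right adjoint has to send [x] to the set of pairs
    [(a, y)] with [a ▷ y ⊑ x], which is already an open of the pullback. What
    needs an argument is that this right adjoint preserves joins, and it is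
    here that local bisections enter: the arrows are covered by partial units
    ([partial_units_cover]), and each partial unit satisfies [s = s ⊙ s° ⊙ s].
    So [s ⊗ y = s ⊗ (s° ▷ s ▷ y)] in the pullback, and to show that an open
    contains [a ⊗ y] it is enough to find [s ⊗ (s° ▷ s ▷ y)] in it for the
    partial units [s ⊑ a] ([ci_partial_units]). If [s ▷ y ⊑ ⋁ S] then
    [s° ▷ s ▷ y ⊑ ⋁ (s° ▷ x)] over the [x] in [S], and [s ▷ s° ▷ x ⊑ x]. The
    same device handles the projection of a product ([qaction_proj]) and the
    two descriptions of morphisms ([lax_hom], [qaction_hom]); associativity
    follows from the adjunctions alone.

    The constructions are mutually inverse because each of the two actions
    determines the other by the equivalence of [a ▷ y ⊑ x] with membership of
    [(a, y)] in the inverse image of [x]. *)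

Set Implicit Arguments.
Unset Strict Implicit.
Unset Printing Implicit Defensive.

Local Open Scope classical_set_scope.
Local Open Scope locale_scope.
Local Obligation Tactic := idtac.

Local Notation "a ⊙ b" := (omul a b) (at level 39, left associativity).
Local Notation "a ▷ x" := (@qact (OG _) _ (qstr _) a x)
  (at level 38, right associativity).

Lemma pbk_leP (X Y Z : locale) (f : lmap X Z) (g : lmap Y Z) (I J : pbk f g) :
  I ⊑ J <-> forall x y, sval I x y -> sval J x y.
Proof. by []. Qed.

(** * The quantale of an étale groupoid *)

Section Quantale.
Context (G : etaleGroupoid).
Implicit Types (a b c s t : arr G) (z w : obj G).
Local Notation e := (oone G).
Local Notation "a '°'" := (ostar a) (at level 2, left associativity, format "a °").

Lemma omulA a b c : a ⊙ (b ⊙ c) = a ⊙ b ⊙ c.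
Proof. exact: (@dactA G (regular G)). Qed.

Lemma omul_mono a a' b b' : a ⊑ a' -> b ⊑ b' -> a ⊙ b ⊑ a' ⊙ b'.
Proof.
move=> ha hb; apply: (@ple_trans _ (a ⊙ b')).
  exact: (mono_of_join (@dact_joinr G (regular G) a) hb).
exact: (mono_of_join (fun S => @dact_joinl G (regular G) S b') ha).
Qed.

Lemma omul1l a : e ⊙ a = a.
Proof. exact: (@dact1 G (regular G)). Qed.

Lemma ostar_mono a b : a ⊑ b -> a° ⊑ b°.
Proof. exact: (mono_of_join (@ostar_join G)). Qed.

Lemma invim_mulE a b c : sval ((mul G)^* c) a b <-> a ⊙ b ⊑ c.
Proof. by rewrite -tens_le tensE -(dirim_adj (mul_open G)). Qed.

Lemma dirim_untE z : dirim (unt G) z = e ⊓ (dom G)^* z.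
Proof.
rewrite -(frobenius (unt_open G)) meetC meet_top; congr dirim.
by rewrite -[LHS](congr1 (fun k : lmap _ _ => k^* z) (dom_unt G)).
Qed.

Lemma dirim_untE' z : dirim (unt G) z = e ⊓ (ran G)^* z.
Proof.
rewrite -(frobenius (unt_open G)) meetC meet_top; congr dirim.
by rewrite -[LHS](congr1 (fun k : lmap _ _ => k^* z) (ran_unt G)).
Qed.

Lemma dirim_untK b : b ⊑ e -> dirim (unt G) ((unt G)^* b) = b.
Proof.
move=> be; rewrite -[X in dirim _ X]meet_top meetC (frobenius (unt_open G)).
by rewrite meetC meet_l.
Qed.

Lemma dirim_unt_le z : dirim (unt G) z ⊑ e.
Proof. by rewrite dirim_untE; lat. Qed.

(** Moving [z] across the balanced tensor turns the factor on the arrows into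
    one on the space, after which only the unit law is left. *)
Lemma dact_unt (X : gLocale G) z (x : X) :
  dact (dirim (unt G) z) x = (proj X)^* z ⊓ x.
Proof.
rewrite -[RHS](@dact1 G X) dirim_untE' /dact !invim_meet.
have /= -> := congr1 (fun k : lmap (pbk (ran G) (proj X)) _ => k^* z)
  (pb_comm (ran G) (proj X)).
by rewrite meetA.
Qed.

Lemma unt_omul z a : dirim (unt G) z ⊙ a = (dom G)^* z ⊓ a.
Proof. exact: (@dact_unt (regular G)). Qed.

Lemma omul_unt a z : a ⊙ dirim (unt G) z = a ⊓ (ran G)^* z.
Proof.
rewrite -[RHS](@omul1r G) dirim_untE /omul !invim_meet.
have /= <- := congr1 (fun k : lmap (pbk (ran G) (dom G)) _ => k^* z)
  (pb_comm (ran G) (dom G)).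
by rewrite [X in _ ⊓ X]meetC meetA.
Qed.

Lemma dirim_unt_meet z w :
  dirim (unt G) (z ⊓ w) = dirim (unt G) z ⊙ dirim (unt G) w.
Proof. by rewrite unt_omul !dirim_untE invim_meet; apply: ple_anti; lat. Qed.

(** * Covering by partial units *)

(** On a chart every open is the restriction of an inverse image along [f], so a
    map into the chart is determined by its composite with [f]. *)
Lemma chart_mono (X Y : locale) (f : lmap X Y) (u : X) (v : Y)
    (h : lmap (opn u) (opn v)) (W : locale) (k l : lmap W X) :
  is_liso h -> opn_incl v ⊚ h = f ⊚ opn_incl u ->
  k^* u = ⊤ -> l^* u = ⊤ -> f ⊚ k = f ⊚ l -> k = l.
Proof.
move=> hi E ku lu fkl; apply: lmap_ext => x.
have chartS u' : [set u] u' -> exists (v : Y) (h : lmap (opn u') (opn v)),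
    is_liso h /\ opn_incl v ⊚ h = f ⊚ opn_incl u'.
  by move=> ->; exists v, h.
have [_ [/(_ x)[w _ xw] _]] := chart chartS (erefl u).
rewrite -[k^* x]meet_top -ku -invim_meet xw invim_meet ku meet_top.
rewrite -[l^* x]meet_top -lu -invim_meet xw invim_meet lu meet_top.
exact: (congr1 (fun m : lmap W Y => m^* w) fkl).
Qed.

Lemma opn_incl_le (X : locale) (u x : X) : (opn_incl u)^* x = ⊤ -> u ⊑ x.
Proof.
rewrite -(invim_top (opn_incl u)) => /(congr1 sval) /= E.
by rewrite -(meet_top u) -E; lat.
Qed.

Lemma opn_incl_self (X : locale) (u x : X) : u ⊑ x -> (opn_incl u)^* x = ⊤.
Proof.
move=> ux; rewrite -(invim_top (opn_incl u)); apply: opn_val_inj => /=.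
by rewrite meet_top meet_l.
Qed.

(** Read with generalized points: a pair [(g, h)] in the product [s° ⊗ s] has
    [g⁻¹] and [h] in [s] with a common domain, so [g⁻¹ = h] and [gh] is a
    unit. *)
Lemma star_mul_le_one_of_dom_injective s :
  (forall (W : locale) (k l : lmap W (arr G)), k^* s = ⊤ -> l^* s = ⊤ ->
     dom G ⊚ k = dom G ⊚ l -> k = l) -> s° ⊙ s ⊑ e.
Proof.
move=> inj; apply/(dirim_adj (mul_open G)); rewrite ostarE.
set c := _ ⊓ _; pose i := opn_incl c; apply: opn_incl_le.
have e0 : ran G ⊚ (pb1 ⊚ i) = dom G ⊚ (pb2 ⊚ i) by rewrite !lcompA pb_comm.
have E : pb1 ⊚ i = inv G ⊚ (pb2 ⊚ i).
  rewrite -(lcomp1f (pb1 ⊚ i)) -(invK G) -lcompA; congr lcomp; apply: inj.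
  - by apply: opn_incl_self; exact: meet_lb1.
  - by apply: opn_incl_self; exact: meet_lb2.
  - by rewrite lcompA dom_inv.
have E1 : mul G ⊚ i = unt G ⊚ (ran G ⊚ (pb2 ⊚ i)).
  have e1 : ran G ⊚ (inv G ⊚ (pb2 ⊚ i)) = dom G ⊚ (pb2 ⊚ i).
    by rewrite lcompA ran_inv.
  rewrite -(muVl e1) /mu; congr lcomp.
  by apply: pb_ext; rewrite ?pb_pairK1 ?pb_pairK2.
have eT : (unt G)^* e = ⊤.
  by apply: ple_anti; [exact: le_top|exact: (dirim_unit (unt_open G))].
by rewrite -[LHS]/((mul G ⊚ i)^* _) E1
  -[LHS]/(i^* (pb2^* ((ran G)^* ((unt G)^* e)))) eT !invim_top.
Qed.

Definition partial_unit s := s ⊙ s° ⊑ e /\ s° ⊙ s ⊑ e.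

(** Injectivity of the domain on [s] bounds [s° ⊙ s] only. The other half is
    injectivity of the range, whose charts are the inverses of those of the
    domain; hence the double cover by all the [s ⊓ t°]. *)
Lemma partial_units_cover a : a = ⋁ [set s | partial_unit s /\ s ⊑ a].
Proof.
apply: ple_anti; last by apply: join_least => s [].
have [S cS chartS] := dom_etale G.
have key s : S s -> s° ⊙ s ⊑ e.
  move=> Ss; have [v [h [hi E]]] := chartS s Ss.
  apply: star_mul_le_one_of_dom_injective => W k l; exact: chart_mono hi E.
rewrite -{1}(meet_top a) -cS meet_join; apply: join_least => _ [s Ss <-].
have cS' : ⋁ [set t° | t in S] = ⊤.
  by rewrite -ostar_join cS ostarE invim_top.
rewrite -{1}(meet_top (a ⊓ s)) -cS' meet_join.
apply: join_least => _ [_ [t St <-] <-]; apply: join_ub; split; last by lat.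
split.
  apply: ple_trans (key _ St); apply: omul_mono; first by lat.
  by rewrite -{2}(ostarK t); apply: ostar_mono; lat.
apply: ple_trans (key _ Ss); apply: omul_mono; last by lat.
by apply: ostar_mono; lat.
Qed.

(** Every arrow [g] satisfies [g⁻¹ g = 1], so the unit at the range of an arrow
    of [s] lies in [s° ⊙ s]. *)
Lemma le_unt_ran s : s ⊑ (ran G)^* ((unt G)^* (s° ⊙ s)).
Proof.
pose j := ⟨ inv G , lid _ | esym (comp_lid_comm (ran_inv G)) ⟩.
have j1 : j^* (pb1^* (s°)) = s.
  have := congr1 (fun k : lmap _ _ => k^* (s°))
    (pb_pairK1 (esym (comp_lid_comm (ran_inv G)))).
  by rewrite -ostarE ostarK.
have j2 : j^* (pb2^* s) = s.
  exact: (congr1 (fun k : lmap _ _ => k^* s)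
    (pb_pairK2 (esym (comp_lid_comm (ran_inv G))))).
have -> : (ran G)^* ((unt G)^* (s° ⊙ s)) = j^* ((mul G)^* (s° ⊙ s)).
  exact: esym (congr1 (fun k : lmap _ _ => k^* (s° ⊙ s)) (mulVl G)).
apply: ple_trans (invim_mono j (dirim_unit (mul_open G) _)).
by rewrite invim_meet j1 j2; lat.
Qed.

Lemma omul_partial_unit s : partial_unit s -> s ⊙ (s° ⊙ s) = s.
Proof.
move=> [_ h]; rewrite -(dirim_untK h) omul_unt meet_l //.
exact: le_unt_ran.
Qed.

End Quantale.

(** * The groupoid action of a Q-locale *)

Section QLocale.
Context (G : etaleGroupoid).
Local Notation e := (oone G).
Local Notation "a '°'" := (ostar a) (at level 2, left associativity, format "a °").

Section Space.
Context (X : qLocale (OG G)).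
Implicit Types (a b c s t : arr G) (z w : obj G) (x y : X).

Lemma qactM a b x : a ▷ b ▷ x = (a ⊙ b) ▷ x.
Proof. exact: (qactA (qstr X)). Qed.

Lemma qact_e x : e ▷ x = x.
Proof. exact: (qact1 (qstr X)). Qed.

Lemma qact_mono a a' x x' : a ⊑ a' -> x ⊑ x' -> a ▷ x ⊑ a' ▷ x'.
Proof.
move=> ha hx; apply: (@ple_trans _ (a ▷ x')).
  exact: (mono_of_join (qact_joinr (qstr X) a) hx).
exact: (mono_of_join (fun S => qact_joinl (qstr X) S x') ha).
Qed.

Lemma qact_le_e b x : b ⊑ e -> b ▷ x = b ▷ ⊤ ⊓ x.
Proof. exact: (@qlocal (OG G) X b x). Qed.

Definition supp z : X := dirim (unt G) z ▷ ⊤.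

Lemma qact_unt z x : dirim (unt G) z ▷ x = supp z ⊓ x.
Proof. exact/qact_le_e/dirim_unt_le. Qed.

Program Definition qproj : lmap X (obj G) := @LMap X (obj G) supp _ _ _.
Next Obligation.
move=> S; rewrite /supp (dirim_join (unt_open G)).
by rewrite -[LHS]/(qact _ _ _) qact_joinl image_comp.
Qed.
Next Obligation.
by move=> z w; rewrite {1}/supp dirim_unt_meet -qactM qact_unt.
Qed.
Next Obligation. by rewrite /supp -[dirim _ _]/e qact_e. Qed.

Lemma qproj_unt z x : dirim (unt G) z ▷ x = qproj^* z ⊓ x.
Proof. exact: qact_unt. Qed.

(** The balancing condition of the pullback, in terms of the quantale: elements
    below the unit pass through the tensor. *)
Lemma ci_move (I : arr G -> X -> Prop) a b x : C_ideal (ran G) qproj I ->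
  b ⊑ e -> I (a ⊙ b) x <-> I a (b ▷ x).
Proof.
move=> CI /dirim_untK <-; rewrite omul_unt qproj_unt [_ ⊓ x]meetC.
exact: (ci_bal CI).
Qed.

(** The step that replaces inverses of arrows: [s ⊗ x = s ⊗ (s° ▷ s ▷ x)] because
    [s = s ⊙ (s° ⊙ s)] and [s° ⊙ s] can be moved to the right. *)
Lemma ci_partial_units (I : arr G -> X -> Prop) a x : C_ideal (ran G) qproj I ->
  (forall s, partial_unit s -> s ⊑ a -> I s (s° ▷ s ▷ x)) -> I a x.
Proof.
move=> CI H; rewrite (partial_units_cover a); apply: (ci_joinl CI) => s [ps sa].
rewrite -(omul_partial_unit ps); apply/(ci_move _ _ CI ps.2).
by rewrite -qactM; exact: H.
Qed.

Lemma qact_unit_l s x : partial_unit s -> s ▷ s° ▷ x ⊑ x.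
Proof.
by move=> ps; rewrite qactM -{2}(qact_e x); apply: qact_mono; [exact: ps.1|lat].
Qed.

Lemma residual_ci x : C_ideal (ran G) qproj (fun a y => a ▷ y ⊑ x).
Proof.
split.
- move=> a a' y y' ha hy; apply: ple_trans; exact: qact_mono.
- move=> S y h; rewrite -[qact _ _ _]/(qact (qstr X) _ _) qact_joinl.
  by apply: join_least => _ [a Sa <-]; exact: h.
- move=> a S h; rewrite qact_joinr.
  by apply: join_least => _ [y Sy <-]; exact: h.
- by move=> a y z; rewrite -omul_unt -qactM qproj_unt meetC.
Qed.

Local Notation P := (pbk (ran G) qproj).

Definition residual x : P := exist _ _ (residual_ci x).

Lemma residualE a y x : tens _ _ a y ⊑ residual x <-> a ▷ y ⊑ x.
Proof. exact: tens_le. Qed.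

(** The right adjoint of [a ⊗ y ↦ a ▷ y], whose preservation of joins is the
    point where partial units are needed. *)
Program Definition qaction : lmap P X := @LMap P X residual _ _ _.
Next Obligation.
move=> S; apply: ple_anti; last first.
  apply: join_least => _ [x Sx <-]; apply/pbk_leP => a y /= h.
  by apply: ple_trans h (join_ub Sx).
set J := ⋁ [set _ | _ in _]; apply/pbk_leP => a y /= h.
apply: (ci_partial_units (svalP J)) => s ps sa.
have : s ▷ y ⊑ ⋁ S by apply: ple_trans h; apply: qact_mono => //; lat.
move=> /(qact_mono (ple_refl (s°))) h'.
apply: (ci_down (svalP J) (ple_refl s) h'); rewrite qact_joinr.
apply: (ci_joinr (svalP J)) => _ [x Sx <-]; apply/tens_le.
apply: (@ple_trans _ (residual x)); last by apply: join_ub; exists x.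
by apply/residualE; exact: qact_unit_l.
Qed.
Next Obligation.
move=> x y; apply: ple_anti.
  by apply: meet_glb; apply/pbk_leP => a z /= h; apply: ple_trans h _; lat.
by apply/pbk_leP => a z /pbk_meetE[h k]; apply: meet_glb.
Qed.
Next Obligation.
by apply: ple_anti; [exact: le_top|apply/pbk_leP => a y _ /=; exact: le_top].
Qed.

Lemma qaction_proj : qproj ⊚ qaction = dom G ⊚ pb1.
Proof.
apply: lmap_ext => z.
rewrite -[LHS]/(residual (qproj^* z)) -[RHS]/(tens _ _ ((dom G)^* z) ⊤).
apply: ple_anti.
  set J := tens _ _ _ _; apply/pbk_leP => a y /= h.
  apply: (ci_partial_units (svalP J)) => s ps sa.
  pose b := dirim (unt G) z.
  (* Since [s ▷ y] lives over [z], the factor [s° ▷ s ▷ y] of the tensor is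
     [(s° ⊙ b ⊙ s) ▷ y], and moving [s° ⊙ b ⊙ s] back to the left leaves an
     element below [b ⊙ s], which has its domain in [z]. *)
  have sy : s ▷ y = b ▷ s ▷ y.
    rewrite qproj_unt meetC meet_l //; apply: ple_trans h.
    by apply: qact_mono => //; lat.
  have be : b ⊑ e by exact: dirim_unt_le.
  have ce : s° ⊙ (b ⊙ s) ⊑ e.
    apply: ple_trans ps.2; apply: omul_mono; first by lat.
    by rewrite -{2}(omul1l s); apply: omul_mono => //; lat.
  rewrite sy (qactM b) qactM; apply/(ci_move _ _ (svalP J) ce).
  apply: tens_in; last exact: le_top.
  rewrite omulA; apply: (@ple_trans _ (b ⊙ s)); last by rewrite unt_omul; lat.
  rewrite -[X in _ ⊑ X]omul1l; apply: omul_mono; [exact: ps.1|lat].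
apply/residualE; rewrite -[(dom G)^* z]meet_top -unt_omul -qactM.
by apply: qact_mono; lat.
Qed.

Lemma tens_assoc a b y :
  (pb_assoc (ran G) (dom G) (ran G) qproj)^* (tens _ _ (tens _ _ a b) y) =
  tens _ _ a (tens _ _ b y).
Proof.
have a1 := congr1 (fun k : lmap _ _ => k^* a)
  (pb_assoc11 (ran G) (dom G) (ran G) qproj).
have a2 := congr1 (fun k : lmap _ _ => k^* b)
  (pb_assoc12 (ran G) (dom G) (ran G) qproj).
have a3 := congr1 (fun k : lmap _ _ => k^* y)
  (pb_assoc2 (ran G) (dom G) (ran G) qproj).
rewrite !tensE !invim_meet -meetA; congr (_ ⊓ (_ ⊓ _)).
- exact: a1.
- exact: a2.
- exact: a3.
Qed.

(** Each inverse image is the join of the tensors below it, and the adjunction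
    between [residual] and the action turns either inclusion into the
    associativity of [▷], so that no left adjoint on the iterated pullback has
    to be computed. *)
Lemma qactionA : qaction ⊚ id_times (ran G) qaction_proj =
  qaction ⊚ times_id qproj (ran_mul G) ⊚ pb_assoc (ran G) (dom G) (ran G) qproj.
Proof.
pose α := pb_assoc (ran G) (dom G) (ran G) qproj.
pose l := id_times (ran G) qaction_proj; pose t := times_id qproj (ran_mul G).
apply: lmap_ext => x.
rewrite -[LHS]/(l^* (residual x)) -[RHS]/(α^* (t^* (residual x))).
apply: ple_anti.
  apply: join_least => _ [c [z [h ->]]].
  change (pb1^* c ⊓ pb2^* (residual z) ⊑ α^* (t^* (residual x))); rewrite -tensE.
  rewrite (pbk_join_tens (residual z)) tens_joinr.
  apply: join_least => _ [_ [b [y [h' ->]]] <-].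
  rewrite -tens_assoc; apply: invim_mono.
  have : tens (ran G) qproj (c ⊙ b) y ⊑ residual x.
    apply/residualE; rewrite -qactM; apply: ple_trans h.
    by apply: qact_mono => //; lat.
  move=> /(invim_mono t); apply: ple_trans.
  have -> : t^* (tens _ _ (c ⊙ b) y) = pb1^* ((mul G)^* (c ⊙ b)) ⊓ pb2^* y.
    exact: (pb_inv_tens (times_id_comm qproj (ran_mul G))).
  rewrite tensE.
  apply: meet_mono; last by lat.
  apply: invim_mono; apply/tens_le/invim_mulE; lat.
rewrite [t^* _]/(pb_inv _ _ _) invim_join.
apply: join_least => _ [_ [c [y [h ->]]] <-].
change (α^* (pb1^* ((mul G)^* c) ⊓ pb2^* y) ⊑ l^* (residual x)).
rewrite -tensE (pbk_join_tens ((mul G)^* c)) tens_joinl invim_join image_comp.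
apply: join_least => _ [_ [a [b [/invim_mulE h' ->]]] <-].
rewrite [_ (tens _ _ _ _)]tens_assoc.
have : tens (ran G) qproj a (b ▷ y) ⊑ residual x.
  apply/residualE; rewrite qactM; apply: ple_trans h.
  by apply: qact_mono => //; lat.
move=> /(invim_mono l); apply: ple_trans.
have -> : l^* (tens _ _ a (b ▷ y)) = pb1^* a ⊓ pb2^* (residual (b ▷ y)).
  exact: (pb_inv_tens (id_times_comm (ran G) qaction_proj)).
rewrite tensE.
apply: meet_mono; first by lat.
by apply: invim_mono; apply/residualE; lat.
Qed.

Lemma qaction1 :
  qaction ⊚ ⟨ unt G ⊚ qproj , lid X | unit_comm qproj (ran_unt G) ⟩ = lid X.
Proof.
apply: lmap_ext => x; apply: ple_anti.
  apply: join_least => _ [a [y [h ->]]].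
  change (supp ((unt G)^* a) ⊓ y ⊑ x); rewrite -qact_unt.
  apply: ple_trans h; apply: qact_mono; last by lat.
  rewrite -[X in dirim _ X]meet_top meetC (frobenius (unt_open G)); lat.
apply: join_ub; exists e, x; split; first by rewrite /= qact_e; lat.
rewrite -[RHS]/(supp ((unt G)^* e) ⊓ x) -qact_unt dirim_untK ?qact_e //; lat.
Qed.

Definition gLocale_of : gLocale G :=
  @GLocale G X qproj qaction qaction_proj qactionA qaction1.

End Space.

(** * Morphisms *)

Section Maps.
Context (X Y : qLocale (OG G)) (f : lmap X Y).

Lemma qproj_hom : (forall a (y : Y), f^* (a ▷ y) = a ▷ f^* y) ->
  qproj Y ⊚ f = qproj X.
Proof.
by move=> h; apply: lmap_ext => z; rewrite /= /supp h invim_top.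
Qed.

(** A lax homomorphism over the objects is strict: for a partial unit [s], the
    inverse image of [s ▷ y] is fixed by [s ⊙ s° ⊑ e], and applying laxness to
    [s°] instead of [s] reverses the inequality. *)
Lemma lax_hom : qproj Y ⊚ f = qproj X ->
  (forall a (y : Y), a ▷ f^* y ⊑ f^* (a ▷ y)) ->
  forall a (y : Y), f^* (a ▷ y) = a ▷ f^* y.
Proof.
move=> fp lax a y; apply: ple_anti => //.
rewrite {1}(partial_units_cover a) -[qact _ _ _]/(qact (qstr Y) _ _) qact_joinl.
rewrite invim_join; apply: join_least => _ [_ [s [ps sa] <-] <-].
have fe b (y' : Y) : b ⊑ e -> f^* (b ▷ y') = b ▷ f^* y'.
  by move=> /dirim_untK <-; rewrite !qproj_unt invim_meet -fp.
rewrite -{1}(omul_partial_unit ps) omulA -qactM fe; last exact: ps.1.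
rewrite -qactM; apply: qact_mono => //; apply: ple_trans (lax _ _) _.
apply: invim_mono; rewrite qactM -[X in _ ⊑ X]qact_e.
by apply: qact_mono; [exact: ps.2|lat].
Qed.

(** For a tensor [s ⊗ x] with [s ▷ x] below the inverse image of [y], the
    intermediate open is the inverse image of [s° ▷ y]. *)
Lemma qaction_hom (fp : qproj Y ⊚ f = qproj X) :
  (forall a (y : Y), f^* (a ▷ y) = a ▷ f^* y) ->
  f ⊚ qaction X = qaction Y ⊚ id_times (ran G) fp.
Proof.
move=> h; apply: lmap_ext => y; pose l := id_times (ran G) fp.
rewrite -[LHS]/(residual (f^* y)) -[RHS]/(l^* (residual y)).
have lE a z : l^* (tens _ _ a z) = tens _ _ a (f^* z).
  by rewrite [RHS]tensE; exact: (pb_inv_tens (id_times_comm (ran G) fp)).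
apply: ple_anti.
  apply/pbk_leP => a x ax.
  apply: (ci_partial_units (svalP (l^* (residual y)))) => s ps sa.
  have sx : s° ▷ s ▷ x ⊑ f^* (s° ▷ y).
    rewrite h; apply: qact_mono; first by lat.
    by apply: ple_trans ax; apply: qact_mono => //; lat.
  apply: (ci_down (svalP (l^* (residual y))) (ple_refl s) sx); apply/tens_le.
  by rewrite -lE; apply: invim_mono; apply/residualE; exact: qact_unit_l.
rewrite (pbk_join_tens (residual y)) invim_join.
apply: join_least => _ [_ [a [z [az ->]]] <-].
by rewrite lE; apply/residualE; rewrite -h; exact: invim_mono.
Qed.

End Maps.

Definition gMap_of (X Y : qLocale (OG G)) (f : qMap X Y) :
  gMap (gLocale_of X) (gLocale_of Y) :=
  @GMap G (gLocale_of X) (gLocale_of Y) f (qproj_hom (qmap_act f))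
    (qaction_hom (qproj_hom (qmap_act f)) (qmap_act f)).

(** * The two functors *)

Definition dmodule (X : gLocale G) : qModule (OG G) X :=
  @QModule (OG G) X (@dact G X) (@dactA G X) (@dact1 G X) (@dact_joinl G X)
    (@dact_joinr G X).

Program Definition qLocale_of (X : gLocale G) : qLocale (OG G) :=
  @QLocale (OG G) X (dmodule X) _.
Next Obligation.
by move=> X b x /dirim_untK <- /=; rewrite !dact_unt meet_top.
Qed.

Lemma qproj_qLocale_of (X : gLocale G) : qproj (qLocale_of X) = proj X.
Proof.
by apply: lmap_ext => z; rewrite /= /supp /= dact_unt meet_top.
Qed.

Lemma dact_le (X : gLocale G) a (x y : X) :
  dact a x ⊑ y <-> sval ((act X)^* y) a x.
Proof. by rewrite -tens_le tensE (dirim_adj (act_open X)). Qed.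

(** Laxness is the unit of the adjunction between direct and inverse image along
    the action of [Y]; strictness comes from [lax_hom]. *)
Lemma gmap_dact (X Y : gLocale G) (f : gMap X Y) a (y : Y) :
  f^* (dact a y) = dact a (f^* y).
Proof.
apply: (@lax_hom (qLocale_of X) (qLocale_of Y)).
  by rewrite !qproj_qLocale_of; exact: gmap_proj.
move=> {}a {}y; apply/(dirim_adj (act_open X)).
have := invim_mono (id_times (ran G) (gmap_proj f))
  (dirim_unit (act_open Y) (pb1^* a ⊓ pb2^* y)).
rewrite -tensE.
have -> : (id_times (ran G) (gmap_proj f))^* (tens _ _ a y) =
    pb1^* a ⊓ pb2^* (f^* y).
  exact: (pb_inv_tens (id_times_comm (ran G) (gmap_proj f))).
move=> h; apply: ple_trans h _; rewrite tensE.
have E := congr1 (fun k : lmap _ _ => k^* (dact a y)) (gmap_act f).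
by rewrite -[X in _ ⊑ X]/((f ⊚ act X)^* _) E; lat.
Qed.

Definition qMap_of (X Y : gLocale G) (f : gMap X Y) :
  qMap (qLocale_of X) (qLocale_of Y) :=
  @QMap (OG G) (qLocale_of X) (qLocale_of Y) f (gmap_dact f).

Program Definition toQLoc : functor (GLoc G) (QLoc (OG G)) :=
  @Functor (GLoc G) (QLoc (OG G)) qLocale_of qMap_of _ _.
Next Obligation. by move=> X; exact: qMap_ext. Qed.
Next Obligation. by move=> X Y Z g f; exact: qMap_ext. Qed.

Program Definition toGLoc : functor (QLoc (OG G)) (GLoc G) :=
  @Functor (QLoc (OG G)) (GLoc G) gLocale_of gMap_of _ _.
Next Obligation. by move=> X; exact: gMap_ext. Qed.
Next Obligation. by move=> X Y Z g f; exact: gMap_ext. Qed.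

(** * The functors are mutually inverse *)

(** The type of the action depends on the projection; comparing the opens of the
    two pullbacks as sets of pairs avoids a transport. *)
Lemma gLocale_ext (S : locale) (p p' : lmap S (obj G))
    (a : lmap (pbk (ran G) p) S) (a' : lmap (pbk (ran G) p') S)
    ap ap' aA aA' a1 a1' :
  p = p' -> (forall x b y, sval (a^* x) b y <-> sval (a'^* x) b y) ->
  @GLocale G S p a ap aA a1 = @GLocale G S p' a' ap' aA' a1'.
Proof.
move=> pE; subst p' => aE; have E : a = a'.
  by apply: lmap_ext => x; apply: ci_ext.
subst a'; rewrite (Prop_irrelevance ap' ap) in aA' *.
by congr GLocale; exact: Prop_irrelevance.
Qed.

Lemma qLocale_ext (S : locale) (m m' : qModule (OG G) S) l l' :
  (forall a x, m a x = m' a x) -> @QLocale (OG G) S m l = @QLocale (OG G) S m' l'.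
Proof.
case: m m' l l' => [m h1 h2 h3 h4] [m' h1' h2' h3' h4'] l l' /= E.
have {}E : m = m' by apply/funext => a; apply/funext => x; exact: E.
subst m'; move: l'; rewrite (Prop_irrelevance h1' h1) (Prop_irrelevance h2' h2).
rewrite (Prop_irrelevance h3' h3) (Prop_irrelevance h4' h4) => l'.
by congr QLocale; exact: Prop_irrelevance.
Qed.

Lemma qLocale_ofK (X : gLocale G) : gLocale_of (qLocale_of X) = X.
Proof.
case: X => S p a ap aA a1; set X := GLocale aA a1.
apply: gLocale_ext (qproj_qLocale_of X) _ => x b y.
exact: (@dact_le X).
Qed.

Lemma gLocale_ofK (X : qLocale (OG G)) : qLocale_of (gLocale_of X) = X.
Proof.
case: X => S m l; set X := QLocale l; apply: qLocale_ext => a x.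
apply: le_eqP => y; exact: (@dact_le (gLocale_of X)).
Qed.

End QLocale.

(** The morphism [fmap E f] and [f] have provably, not definitionally, equal
    types. A faithful underlying-map assignment [u] lets the comparison take
    place in a dependent sum, where it holds by reflexivity for functors that
    keep the underlying objects and maps. *)
Lemma functor_eq_fid (C : category) (E : functor C C)
    (T : Type) (U : C -> T) (V : T -> T -> Type)
    (u : forall x y : C, hom x y -> V (U x) (U y)) :
  (forall x y (f g : hom x y), u x y f = u x y g -> f = g) ->
  (forall x, E x = x) ->
  (forall x y (f : hom x y),
    existT (fun p => V p.1 p.2) (U (E x), U (E y)) (u _ _ (fmap E f)) =
    existT (fun p => V p.1 p.2) (U x, U y) (u _ _ f)) ->
  E = fid C.
Proof.
case: E => [o m m1 mM] /= u_inj oE.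
have {}oE : o = (fun x => x) by exact: funext.
subst o => mE; have {}mE : m = fun x y f => f.
  apply: functional_extensionality_dep => x.
  apply: functional_extensionality_dep => y.
  apply: functional_extensionality_dep => f; apply: u_inj.
  have := projT2_eq (mE x y f).
  by rewrite (Prop_irrelevance (projT1_eq (mE x y f)) erefl).
by subst m; congr Functor; exact: Prop_irrelevance.
Qed.

Theorem theorem3p21 (G : etaleGroupoid) :
  isomorphic_categories (GLoc G) (QLoc (OG G)).
Proof.
exists (toQLoc G), (toGLoc G); split.
  apply: (@functor_eq_fid (GLoc G) _ locale (@gspace G) lmap (@gmap G)) => //.
    exact: gMap_ext.
  exact: qLocale_ofK.
apply: (@functor_eq_fid (QLoc (OG G)) _ locale (@qspace (OG G)) lmap
  (@qmap (OG G))) => //.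
  exact: qMap_ext.
exact: gLocale_ofK.
Qed.
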